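(* Assume that $\mathcal{G}$ is connected. Then the real spectrum $\mathrm{Sp}_{\mathbb{R}}(B)$ (the set of real eigenvalues) of the matrix $B$ is a nonempty set, and $\gamma = \max \mathrm{Sp}_{\mathbb{R}}(B)$ is an algebraically simple eigenvalue of $B$ whose associated eigenspace is spanned by a column vector $f = (f_1,\ldots,f_N)'$ with positive coefficients. Moreover, $\gamma$ is the ergodic constant associated with the control problem described in the context, and $$\exists \alpha \in \mathbb{R}, \ \forall i \in \mathcal{N}, \ \forall t \in \mathbb{R}, \quad \lim_{T\to+\infty} \left(u^T_i(t) - \gamma(T-t)\right) = \alpha + \log(f_i).$$ The resulting asymptotic behavior of the optimal controls is given by $$\forall i \in \mathcal{N}, \ \forall j \in \mathcal{V}(i), \ \forall t \in \mathbb{R}, \quad \lim_{T\to+\infty} \lambda^{T*}_t(i,j) = \bar\lambda_{ij}\frac{f_j}{f_i}.$$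
   Context: Let $\mathcal{G}$ be a finite directed graph with no self-loop, with set of nodes $\mathcal{N} = \{1,\ldots,N\}$, $N \ge 2$. For each $i \in \mathcal{N}$, $\mathcal{V}(i) \subset \mathcal{N}\setminus\{i\}$ denotes the set of nodes $j$ for which there is a directed edge from $i$ to $j$. The graph $\mathcal{G}$ is said to be connected if for all $i,j\in\mathcal{N}$ there exist $K\ge 2$ and $i_1,\ldots,i_K\in\mathcal{N}$ such that $i_1=i$, $i_K=j$ and $i_{k+1}\in\mathcal{V}(i_k)$ for all $k\in\{1,\ldots,K-1\}$. Let $r : \mathcal{N} \to \mathbb{R}$ (instantaneous reward) and $g : \mathcal{N} \to \mathbb{R}$ (terminal reward) be functions, and let $(\bar\lambda_{ij})_{i \in \mathcal{N}, j \in \mathcal{V}(i)}$ be positive real numbers. For a time horizon $T>0$ and a time $t\le T$, the set of admissible controls $\mathcal{A}^T_t$ is the set of families $(\lambda_s(i,j))_{s\in[t,T], i\in\mathcal{N}, j\in\mathcal{V}(i)}$ that are deterministic, nonnegative, and such that for all $i \in \mathcal{N}$ and $j\in\mathcal{V}(i)$ the function $s\mapsto \lambda_s(i,j)$ is in $L^1(t,T)$. Cost: for $i\in\mathcal{N}$ and $(\lambda_{ij})_{j\in\mathcal{V}(i)} \in \mathbb{R}_+^{|\mathcal{V}(i)|}$, $$L\left(i,(\lambda_{ij})_{j\in\mathcal{V}(i)}\right) = -r(i) + \sum_{j\in\mathcal{V}(i)}\left(\lambda_{ij}\log\left(\frac{\lambda_{ij}}{\bar\lambda_{ij}}\right) +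 \bar\lambda_{ij} - \lambda_{ij}\right),$$ with the convention that $x\log(x)$ is extended by continuity by the value $0$ at $x=0$. For $\lambda\in\mathcal{A}^T_t$, $(X^{t,i,\lambda}_s)_{s\in[t,T]}$ denotes the continuous-time Markov chain on $\mathcal{G}$ starting from node $i$ at time $t$ with (time-dependent) transition intensities given by $\lambda$ (at time $s$, the intensity of jumping from $k$ to $j\in\mathcal{V}(k)$ is $\lambda_s(k,j)$), defined on a filtered probability space satisfying the usual conditions. The value function of the control problem is, for $i\in\mathcal{N}$ and $t\le T$, $$u^T_i(t) = \sup_{\lambda \in \mathcal{A}^T_t} \mathbb{E}\left[-\int_t^T L\left(X^{t,i,\lambda}_s, \left(\lambda_s(X^{t,i,\lambda}_s, j)\right)_{j \in \mathcal{V}(X^{t,i,\lambda}_s)}\right)ds + g\left(X^{t,i,\lambda}_T\right)\right].$$ The ergodic constant associated with the control problem is the limit $\lim_{T\to+\infty} \frac{u^T_i(t)}{T}$, when it exists and is independent of $i$ and $t$. Matrix $B$: $B = R + \bar\Lambda$, where $R = \mathrm{diag}(r(1),\ldots,r(N))$ and $\bar\Lambda$ is the $N\times N$ matrix with $\bar\Lambda_{ij} = \bar\lambda_{ij}$ if $j\in\mathcal{V}(i)$, $\bar\Lambda_{ii} = -\sum_{k\in\mathcal{V}(i)}\bar\lambda_{ik}$, and $\bar\Lambda_{ij}=0$ otherwise. The column vector $\mathfrak{g}$ is $(e^{g(1)},\ldots,e^{g(N)})'$, where $'$ denotes transposition, and for $t\le T$, $w^T(t) = e^{B(T-t)}\mathfrak{g}$,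 whose coordinates are all positive. The optimal control $\lambda^{T*}$ of the problem with horizon $T$ is the feedback control given by $\lambda^{T*}_t(i,j) = \bar\lambda_{ij}\frac{w^T_j(t)}{w^T_i(t)}$ for $i\in\mathcal{N}$, $j\in\mathcal{V}(i)$, $t\le T$. *)

(* Defs.v *)
(* MathComp / MathComp-Analysis. *)
From HB Require Import structures.
From mathcomp Require Import all_boot all_order all_algebra.
From mathcomp Require Import all_classical all_reals all_analysis.

Set Implicit Arguments.
Unset Strict Implicit.
Unset Printing Implicit Defensive.

Import Order.TTheory GRing.Theory Num.Theory.
Import numFieldNormedType.Exports.

Local Open Scope classical_set_scope.
Local Open Scope ring_scope.

(* The graph is given by its out-neighbourhoods [V i].  The walk
   [i_1 = i, ..., i_K = j] is [i :: p]; [K >= 2] is [p != [::]], so the trivial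
   walk is not allowed even when [i = j]. *)
Definition connected_graph (N : nat) (V : 'I_N -> {set 'I_N}) : Prop :=
  forall i j : 'I_N, exists p : seq 'I_N,
    [/\ p != [::], path (fun a b => b \in V a) i p & last i p = j].

(* A control maps a time and an edge to an intensity.  It is a total function,
   but only its values at times in [t, T] and on edges are ever used. *)
Definition control (R : realType) (N : nat) := R -> 'I_N -> 'I_N -> R.

Definition admissible (R : realType) (N : nat) (V : 'I_N -> {set 'I_N})
    (t T : R) (l : control R N) : Prop :=
  forall i j : 'I_N, j \in V i ->
    (forall s, s \in `[t, T] -> 0 <= l s i j) /\
    (@lebesgue_measure R).-integrable `[t, T] (EFin \o (fun s => l s i j)).

(* [ln 0 = 0] and [0 / x = 0], hence a term with [l j = 0] is [lbar i j], as
   required by the convention [0 log 0 = 0]. *)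
Definition cost (R : realType) (N : nat) (V : 'I_N -> {set 'I_N})
    (lbar : 'I_N -> 'I_N -> R) (r : 'I_N -> R) (i : 'I_N) (l : 'I_N -> R) : R :=
  - r i + \sum_(j in V i) (l j * ln (l j / lbar i j) + lbar i j - l j).

Definition intensity_mx (R : realType) (N : nat) (V : 'I_N -> {set 'I_N})
    (l : 'I_N -> 'I_N -> R) : 'M[R]_N :=
  \matrix_(i, j) if j \in V i then l i j
                 else if j == i then - \sum_(k in V i) l i k else 0.

Definition usual_conditions (R : realType) (d : measure_display)
    (Omega : measurableType d) (P : probability Omega R)
    (F : R -> set (set Omega)) : Prop :=
  [/\ forall s, sigma_algebra setT (F s) /\ F s `<=` measurable,
      forall s u, s <= u -> F s `<=` F u,
      forall s, P.-negligible `<=` F s &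
      forall s, \bigcap_(u in [set u | s < u]) F u `<=` F s].

(* Forward Kolmogorov equation in integral form, for the transition
   probabilities [p s u k j] from [k] at time [s] to [j] at time [u].  As the
   intensities are only integrable in time, the differential form would hold
   almost everywhere only. *)
Definition kolmogorov_forward (R : realType) (N : nat) (V : 'I_N -> {set 'I_N})
    (t T : R) (l : control R N) (p : R -> R -> 'M[R]_N) : Prop :=
  forall (s u : R) (k j : 'I_N), t <= s -> s <= u -> u <= T ->
    let rate v := (p s v *m intensity_mx V (l v)) k j in
    (@lebesgue_measure R).-integrable `[s, u] (EFin \o rate) /\
    p s u k j = (k == j)%:R + \int[@lebesgue_measure R]_(v in `[s, u]) rate v.

(* [X] is a continuous-time Markov chain on [t, T], relative to the filtration
   [F], started from [i] at time [t], with intensities [l].  The Markov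
   property [P (X_u = j | F_s) = p s u X_s j] is written by integrating over
   the events [A `&` [X_s = k]] with [A] in [F s]. *)
Definition markov_chain (R : realType) (N : nat) (V : 'I_N -> {set 'I_N})
    (d : measure_display) (Omega : measurableType d) (P : probability Omega R)
    (F : R -> set (set Omega)) (t T : R) (i : 'I_N) (l : control R N)
    (X : R -> Omega -> 'I_N) : Prop :=
  [/\ forall w, X t w = i,
      forall s k, s \in `[t, T] -> F s (X s @^-1` [set k]),
      forall w s, s \in `[t, T[ -> \forall u \near s^'+, X u w = X s w,
      forall w s, s \in `]t, T] -> exists k, \forall u \near s^'-, X u w = k &
      exists2 p : R -> R -> 'M[R]_N, kolmogorov_forward V t T l p &
        forall (s u : R) (k j : 'I_N) (A : set Omega),
          t <= s -> s <= u -> u <= T -> F s A ->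
          P (A `&` X s @^-1` [set k] `&` X u @^-1` [set j]) =
            (P (A `&` X s @^-1` [set k]) * (p s u k j)%:E)%E].

(* Extended-real valued: the running cost is bounded below, but its integral
   may be [+oo] for an admissible control, whose reward is then [-oo]. *)
Definition expected_reward (R : realType) (N : nat) (V : 'I_N -> {set 'I_N})
    (lbar : 'I_N -> 'I_N -> R) (r g : 'I_N -> R)
    (d : measure_display) (Omega : measurableType d) (P : probability Omega R)
    (t T : R) (l : control R N) (X : R -> Omega -> 'I_N) : \bar R :=
  (\int[P]_w
     (- (\int[@lebesgue_measure R]_(s in `[t, T])
           (cost V lbar r (X s w) (l s (X s w)))%:E)
      + (g (X T w))%:E))%E.

(* [X T t i l] is the chain with horizon [T] and control [l], started from [i]
   at time [t]. *)
Definition value (R : realType) (N : nat) (V : 'I_N -> {set 'I_N})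
    (lbar : 'I_N -> 'I_N -> R) (r g : 'I_N -> R)
    (d : measure_display) (Omega : measurableType d) (P : probability Omega R)
    (X : R -> R -> 'I_N -> control R N -> R -> Omega -> 'I_N)
    (T : R) (i : 'I_N) (t : R) : \bar R :=
  ereal_sup [set expected_reward V lbar r g P t T l (X T t i l) |
             l in [set l | admissible V t T l]].

Definition ergodic_constant (R : realType) (N : nat)
    (u : R -> 'I_N -> R -> \bar R) (c : R) : Prop :=
  forall (i : 'I_N) (t : R), (u T i t * (T^-1)%:E)%E @[T --> +oo] --> c%:E.

Definition reward_mx (R : realType) (N : nat) (V : 'I_N -> {set 'I_N})
    (lbar : 'I_N -> 'I_N -> R) (r : 'I_N -> R) : 'M[R]_N :=
  diag_mx (\row_i r i) + intensity_mx V lbar.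

Definition real_spectrum (R : realType) (N : nat) (A : 'M[R]_N) : set R :=
  [set x | eigenvalue A x].

Definition expmx (R : realType) (N : nat) (A : 'M[R]_N) : 'M[R]_N :=
  \matrix_(i, j) limn (series (fun k => (k`!%:R^-1 *: A ^+ k) i j)).

Definition w_vec (R : realType) (N : nat) (V : 'I_N -> {set 'I_N})
    (lbar : 'I_N -> 'I_N -> R) (r g : 'I_N -> R) (T t : R) : 'cV[R]_N :=
  expmx ((T - t) *: reward_mx V lbar r) *m (\col_i expR (g i)).

Definition optimal_control (R : realType) (N : nat) (V : 'I_N -> {set 'I_N})
    (lbar : 'I_N -> 'I_N -> R) (r g : 'I_N -> R) (T t : R) (i j : 'I_N) : R :=
  lbar i j * (w_vec V lbar r g T t j 0 / w_vec V lbar r g T t i 0).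

(* Main.v *)
(* With w = e^(B(T-t)) e^g, the function ln w solves the Hamilton-Jacobi-
   Bellman equation. Along a chain of marginals m, the forward Kolmogorov
   equation and an integration by parts give E[g(X_T)] - ln w_i(t) as an
   integral over time and states; the entropic Young inequality compares its
   integrand with the cost, with equality for the optimal control. Hence u =
   ln w.

   The matrix B + c is nonnegative and irreducible for c large, so that B has
   a positive eigenvector f (Collatz-Wielandt) and e^B has positive entries.
   After conjugation by f and multiplication by e^(-gamma x), the flow e^(xB)
   becomes a stochastic semigroup that contracts oscillations, hence
   e^(-gamma x) (e^(xB) v)_i / f_i has a limit independent of i for every
   vector v. This convergence yields the asymptotics of u and of the optimal
   control, and also the spectral claims: applied to another eigenvector, or
   to a Jordan chain above f, it gives the maximality and the simplicity of
   gamma. *)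

Require Import Defs.
From HB Require Import structures.
From mathcomp Require Import all_boot all_order all_algebra.
From mathcomp Require Import all_classical all_reals all_analysis.
From mathcomp Require Import measurable_realfun ring lra.

Import Order.TTheory GRing.Theory Num.Theory.
Import numFieldNormedType.Exports.

Local Open Scope classical_set_scope.
Local Open Scope ring_scope.

Set Implicit Arguments.
Unset Strict Implicit.
Unset Printing Implicit Defensive.

(** * The matrix exponential *)

Lemma exprZmx (R : comPzRingType) (n : nat) (x : R) (A : 'M[R]_n) (k : nat) :
  (x *: A) ^+ k = x ^+ k *: A ^+ k.
Proof.
elim: k => [|k IHk]; first by rewrite !expr0 scale1r.
by rewrite !exprS IHk -!mulmxE -scalemxAl -scalemxAr scalerA.
Qed.

(** The total absolute mass of [A] bounds every column sum, so each further factor multiplies the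
    bound by at most that mass. *)
Lemma mx_norm_expr_le (R : realType) (n : nat) (A : 'M[R]_n) (k : nat)
    (i j : 'I_n) :
  `|(A ^+ k) i j| <= (\sum_i' \sum_j' `|A i' j'|) ^+ k.
Proof.
elim: k i j => [|k IHk] i j.
  by rewrite !expr0 mxE; case: eqP => _; rewrite ?normr1 ?normr0.
rewrite exprSr -mulmxE mxE (le_trans (ler_norm_sum _ _ _))//.
set C := \sum_i' _.
have Cge : \sum_m `|A m j| <= C.
  by apply: ler_sum => m _; rewrite (bigD1 j)//= lerDl sumr_ge0.
rewrite [C ^+ _]exprSr; apply: (le_trans _ (ler_wpM2l _ Cge)).
  by rewrite mulr_sumr; apply: ler_sum => m _; rewrite normrM ler_wpM2r.
by rewrite exprn_ge0// sumr_ge0// => m _; rewrite sumr_ge0.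
Qed.

(** Taylor coefficients in x of the (i, j) entry of e^(xA) M. The factor [M] is kept because
    differentiation replaces it by [A *m M] and so stays in the same family. *)
Definition expmx_coeff {R : realType} {n : nat} (A : 'M[R]_n) p
    (M : 'M[R]_(n, p)) (i : 'I_n) (j : 'I_p) (k : nat) : R :=
  k`!%:R^-1 * (A ^+ k *m M) i j.

(** Absolute comparison with a multiple of the scalar exponential series at C |x|. *)
Lemma is_cvg_expmx_coeff (R : realType) (n : nat) (A : 'M[R]_n) p
    (M : 'M[R]_(n, p)) (i : 'I_n) (j : 'I_p) (x : R) :
  cvgn (pseries (expmx_coeff A M i j) x).
Proof.
apply: normed_cvg.
set C := \sum_i' \sum_j' `|A i' j'|; set K := \sum_m `|M m j|.
have C0 : 0 <= C by apply: sumr_ge0 => ? _; apply: sumr_ge0.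
apply: (@series_le_cvg _ _ (K *: exp_coeff (C * `|x|))).
- by move=> k; exact: normr_ge0.
- move=> k; rewrite /exp_coeff /= mulr_ge0 ?sumr_ge0// divr_ge0//.
  by rewrite exprn_ge0// mulr_ge0.
- move=> k.
  have AM : `|(A ^+ k *m M) i j| <= C ^+ k * K.
    rewrite mxE (le_trans (ler_norm_sum _ _ _))// mulr_sumr.
    apply: ler_sum => m _; rewrite normrM ler_wpM2r//.
    exact: mx_norm_expr_le.
  rewrite /expmx_coeff /exp_coeff /= !normrM normrX ger0_norm ?invr_ge0//.
  rewrite -[(K *: _) k]/(K * _) exprMn.
  rewrite (_ : K * _ = k`!%:R^-1 * (C ^+ k * K) * `|x| ^+ k); last by ring.
  by rewrite ler_wpM2r ?exprn_ge0// ler_wpM2l ?invr_ge0.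
- by apply: is_cvg_seriesZ; exact: is_cvg_series_exp_coeff.
Qed.

Lemma expmxZ_mul (R : realType) (n : nat) (A : 'M[R]_n) p
    (M : 'M[R]_(n, p)) (x : R) (i : 'I_n) (j : 'I_p) :
  (expmx (x *: A) *m M) i j = limn (pseries (expmx_coeff A M i j) x).
Proof.
apply/esym/cvg_lim => //; rewrite mxE.
have -> : pseries (expmx_coeff A M i j) x =
    (fun N => \sum_m pseries (expmx_coeff A 1%:M i m) x N * M m j).
  apply/funext => N; rewrite /pseries/series/=.
  under [RHS]eq_bigr => m _ do rewrite mulr_suml.
  rewrite exchange_big/=; apply: eq_bigr => k _.
  rewrite /expmx_coeff mxE mulr_sumr mulr_suml; apply: eq_bigr => m _.
  by rewrite mulmx1; ring.
apply: cvg_big => [|m _]; first exact: add_continuous.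
suff -> : expmx (x *: A) i m = limn (pseries (expmx_coeff A 1%:M i m) x).
  by apply: cvgMr_tmp; exact: is_cvg_expmx_coeff.
rewrite mxE; congr (limn _); apply/funext => N; apply: eq_bigr => k _.
by rewrite /pseries/expmx_coeff/= mulmx1 exprZmx !mxE; ring.
Qed.

(** Term-by-term differentiation: the shifted coefficients for [M] are those for [A *m M], so all
    derived series converge everywhere. *)
Lemma is_derive_expmxZ_mul (R : realType) (n : nat) (A : 'M[R]_n) p
    (M : 'M[R]_(n, p)) (i : 'I_n) (j : 'I_p) (x : R) :
  is_derive x (1 : R) (fun y => (expmx (y *: A) *m M) i j)
    ((expmx (x *: A) *m (A *m M)) i j).
Proof.
have dif (M' : 'M[R]_(n, p)) :
    pseries_diffs (expmx_coeff A M' i j) = expmx_coeff A (A *m M') i j.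
  apply/funext => k; rewrite /pseries_diffs/expmx_coeff exprSr -mulmxE mulmxA.
  by rewrite factS natrM invfM mulrA mulrA mulfV ?mul1r.
have -> : (fun y => (expmx (y *: A) *m M) i j) =
    (fun y => limn (pseries (expmx_coeff A M i j) y)).
  by apply/funext => y; exact: expmxZ_mul.
rewrite expmxZ_mul -dif; apply: (@pseries_snd_diffs _ _ (`|x| + 1)).
- exact: is_cvg_expmx_coeff.
- by rewrite dif; exact: is_cvg_expmx_coeff.
- by rewrite !dif; exact: is_cvg_expmx_coeff.
- by rewrite [ltRHS]ger0_norm ?ltrDl// addr_ge0.
Qed.

Lemma expmx0 (R : realType) (n : nat) : expmx (0 : 'M[R]_n) = 1%:M.
Proof.
apply/matrixP => i j; rewrite mxE; apply/cvg_lim => //.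
rewrite -cvg_shiftS /=; apply: cvg_near_cst; near=> k.
rewrite /series/= big_nat_recl//= big1.
  by rewrite addr0 expr0 fact0 invr1 scale1r.
by move=> m _; rewrite exprS mul0r scaler0 mxE.
Unshelve. all: by end_near. Qed.

Lemma expmx_comm (R : realType) (n : nat) (A : 'M[R]_n) (x : R) :
  A *m expmx (x *: A) = expmx (x *: A) *m A.
Proof.
apply/matrixP => i j; rewrite expmxZ_mul; apply/esym/cvg_lim => //.
have -> : pseries (expmx_coeff A A i j) x =
    (fun N => \sum_m A i m * pseries (expmx_coeff A 1%:M m j) x N).
  apply/funext => N; rewrite /pseries/series/=.
  under [RHS]eq_bigr => m _ do rewrite mulr_sumr.
  rewrite exchange_big/=; apply: eq_bigr => k _.
  rewrite /expmx_coeff mulmxE -exprSr exprS -mulmxE mxE mulr_sumr mulr_suml.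
  by apply: eq_bigr => m _; rewrite mulmx1; ring.
rewrite mxE; apply: cvg_big => [|m _]; first exact: add_continuous.
rewrite -[expmx _]mulmx1 expmxZ_mul.
by apply: cvgMl_tmp; exact: is_cvg_expmx_coeff.
Qed.

(** Uniqueness for the linear equation: e^((x-z)A) D(z) has zero derivative in z and is compared at
    z = 0 and z = x. Later closed forms of exponentials are obtained by exhibiting a solution. *)
Lemma linear_ode_expmx (R : realType) (n p : nat) (A : 'M[R]_n)
    (D : R -> 'M[R]_(n, p)) :
  (forall x i j, is_derive x (1 : R) (fun y => D y i j) ((A *m D x) i j)) ->
  forall x, D x = expmx (x *: A) *m D 0.
Proof.
move=> dD x; apply/matrixP => i j.
have dG y : is_derive y (1 : R)
    (fun z => (expmx ((x - z) *: A) *m D z) i j) 0.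
  have -> : (fun z => (expmx ((x - z) *: A) *m D z) i j) =
      \sum_m (fun z => expmx ((x - z) *: A) i m * D z m j).
    by rewrite fct_sumE; apply/funext => z; rewrite mxE.
  have dE m : is_derive y (1 : R) (fun z => expmx ((x - z) *: A) i m)
      (- (expmx ((x - y) *: A) *m A) i m).
    have := is_derive_expmxZ_mul A 1%:M i m (x - y).
    rewrite mulmx1 => dE.
    have -> : (fun z => expmx ((x - z) *: A) i m) =
        (fun y => (expmx (y *: A) *m 1%:M) i m) \o (fun z => x - z).
      by apply/funext => z; rewrite /= mulmx1.
    have dx : is_derive y (1 : R) (fun z => x - z) (- 1).
      have := is_deriveB (is_derive_cst x y 1) (is_derive_id y 1).
      by rewrite sub0r.
    rewrite -mulrN1; exact: (@is_derive1_comp _ _ (fun z => x - z)) dE dx.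
  have dED m := is_deriveM (dE m) (dD y m j).
  have dS := is_derive_sum dED; apply: (is_derive_eq dS).
  rewrite big_split/= -[RHS](subrr ((expmx ((x - y) *: A) *m A *m D y) i j)).
  congr (_ + _); first by rewrite -mulmxA mxE.
  rewrite mxE -sumrN; apply: eq_bigr => m _.
  by rewrite -[_ *: _]/(_ * _); ring.
have := is_derive_0_is_cst x 0 dG.
by rewrite subrr scale0r expmx0 mul1mx subr0.
Qed.

Lemma is_derive_expRMl (R : realType) (a x : R) :
  is_derive x (1 : R) (fun y => expR (a * y)) (a * expR (a * x)).
Proof.
have dx : is_derive x (1 : R) (fun z => a * z) a.
  have := is_deriveZ a (is_derive_id x (1 : R)).
  by rewrite -[a *: 1]/(a * 1) mulr1.
by rewrite mulrC; exact: (is_derive1_comp (is_derive_expR (a * x)) dx).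
Qed.

Lemma expmx_jordan (R : realType) (n : nat) (A : 'M[R]_n) (v f : 'cV[R]_n)
    (a c : R) :
  A *m f = a *: f -> A *m v = a *: v + c *: f ->
  forall x, expmx (x *: A) *m v = expR (a * x) *: (v + (c * x) *: f).
Proof.
move=> Af Av x.
pose D x := expR (a * x) *: (v + (c * x) *: f).
have D0 : D 0 = v by rewrite /D !mulr0 expR0 scale0r addr0 scale1r.
rewrite -[RHS]/(D x) -[X in _ *m X]D0; apply/esym/linear_ode_expmx => {}x i j.
have -> : (fun y => D y i j) =
    (fun y => expR (a * y)) * (fun y => v i j + c * y * f i j).
  by apply/funext => y; rewrite /D !mxE.
have dv : is_derive x (1 : R) (fun y => v i j + c * y * f i j) (c * f i j).
  have := is_deriveD (is_derive_cst (v i j) x 1)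
    (is_deriveZ (c * f i j) (is_derive_id x (1 : R))).
  rewrite add0r -[_ *: 1]/(_ * 1) mulr1.
  congr (is_derive _ _ _ _); apply/funext => y.
  by rewrite -[LHS]/(v i j + c * f i j * y); ring.
apply: (is_derive_eq (is_deriveM (is_derive_expRMl a x) dv)).
rewrite -![_ *: (_ : R^o)]/(_ * _) /D -scalemxAr mulmxDr Av -scalemxAr Af.
by rewrite !mxE; ring.
Qed.

Lemma expmx_eigen (R : realType) (n : nat) (A : 'M[R]_n) (v : 'cV[R]_n)
    (a : R) : A *m v = a *: v ->
  forall x, expmx (x *: A) *m v = expR (a * x) *: v.
Proof.
move=> Av x; rewrite (@expmx_jordan _ _ A v 0 a 0) ?scaler0 ?mulmx0 ?addr0//.
Qed.

Lemma expmxD (R : realType) (n : nat) (A : 'M[R]_n) (x y : R) :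
  expmx ((x + y) *: A) = expmx (x *: A) *m expmx (y *: A).
Proof.
have := @linear_ode_expmx _ _ _ A (fun x => expmx ((x + y) *: A)).
rewrite add0r; apply => {}x i j.
have dE := is_derive_expmxZ_mul A 1%:M i j (x + y).
have dx : is_derive x (1 : R) (fun z => z + y) 1.
  by have := is_deriveD (is_derive_id x (1 : R)) (is_derive_cst y x 1);
    rewrite addr0.
have := @is_derive1_comp _ _ (fun z => z + y) _ _ _ dE dx.
rewrite mulr1 mulmx1 -expmx_comm; congr (is_derive _ _ _ _).
by apply/funext => z; rewrite /= mulmx1.
Qed.

Lemma is_derive_expmx_mul (R : realType) (n p : nat) (A : 'M[R]_n)
    (M : 'M[R]_(n, p)) (i : 'I_n) (j : 'I_p) (x : R) :
  is_derive x (1 : R) (fun y => (expmx (y *: A) *m M) i j)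
    ((A *m (expmx (x *: A) *m M)) i j).
Proof.
by have := is_derive_expmxZ_mul A M i j x; rewrite !mulmxA expmx_comm.
Qed.

Lemma expmxD_scalar (R : realType) (n : nat) (A : 'M[R]_n) (c x : R) :
  expmx (x *: (A + c%:M)) = expR (c * x) *: expmx (x *: A).
Proof.
pose D x := expR (c * x) *: expmx (x *: A).
have D0 : D 0 = 1%:M by rewrite /D mulr0 scale0r expmx0 expR0 scale1r.
rewrite -[RHS]/(D x) -[LHS]mulmx1 -D0.
apply/esym/linear_ode_expmx => {}x i j.
have -> : (fun y => D y i j) =
    (fun y => expR (c * y)) * (fun y => (expmx (y *: A) *m 1%:M) i j).
  by apply/funext => y; rewrite /D /GRing.mul/= mulmx1 mxE.
apply: (is_derive_eq
  (is_deriveM (is_derive_expRMl c x) (is_derive_expmx_mul A 1%:M i j x))).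
rewrite -![_ *: (_ : R^o)]/(_ * _).
rewrite /D mulmx1 -scalemxAr mulmxDl mul_scalar_mx.
by rewrite !mxE; ring.
Qed.

(** A single term bounds a series of nonnegative terms from below. The term k = 0 gives
    nonnegativity of the exponential; k equal to the length of a walk gives strict positivity. *)
Lemma expmx_ge (R : realType) (n : nat) (A : 'M[R]_n) (x : R) (k : nat)
    (i j : 'I_n) : (forall i j, 0 <= A i j) -> 0 <= x ->
  k`!%:R^-1 * (A ^+ k) i j * x ^+ k <= expmx (x *: A) i j.
Proof.
move=> A0 x0.
have Ak0 m i' j' : 0 <= (A ^+ m) i' j'.
  elim: m i' j' => [|m IHm] i' j'; first by rewrite expr0 mxE.
  by rewrite exprS -mulmxE mxE sumr_ge0// => l _; rewrite mulr_ge0.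
rewrite -[expmx _]mulmx1 expmxZ_mul.
have u0 m : 0 <= expmx_coeff A 1%:M i j m * x ^+ m.
  by rewrite /expmx_coeff mulmx1 !mulr_ge0 ?invr_ge0 ?exprn_ge0.
apply: limr_ge; first exact: is_cvg_expmx_coeff.
near=> N; rewrite /pseries/series/=.
have kN : (k < N)%N by near: N; exact: nbhs_infty_gt.
rewrite (bigD1_seq k) ?mem_index_iota ?iota_uniq//=.
by rewrite {1}/expmx_coeff mulmx1 lerDl sumr_ge0.
Unshelve. all: by end_near. Qed.

(** * Convergence of the normalised flow *)

Lemma pos_finfun_lbound (R : realFieldType) (I : finType) (F : I -> R) :
  (forall i, 0 < F i) -> exists2 d, 0 < d <= 1 & forall i, d <= F i.
Proof.
move=> F0; have S0 : 0 <= \sum_i (F i)^-1.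
  by apply: sumr_ge0 => i _; rewrite invr_ge0 ltW.
have S1 : 0 < 1 + \sum_i (F i)^-1 by rewrite ltr_wpDr.
(* This replaces a minimum: it is at most 1 and at most each [F i], also when [I] is empty. *)
exists (1 + \sum_i (F i)^-1)^-1.
  by rewrite invr_gt0 S1 invf_le1// lerDl.
move=> i; rewrite -[leRHS]invrK lef_pV2 ?posrE ?invr_gt0// (bigD1 i)//=.
rewrite addrCA lerDl addr_ge0// sumr_ge0// => j _.
by rewrite invr_ge0 ltW.
Qed.

(** Subtracting a leaves a sum of nonnegative terms, of which only the one at [i0] is kept. *)
Lemma weighted_mean_ge (R : realDomainType) (I : finType) (p h : I -> R)
    (i0 : I) (d a : R) :
  (forall i, 0 <= p i) -> \sum_i p i = 1 -> d <= p i0 ->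
  (forall i, a <= h i) -> a + d * (h i0 - a) <= \sum_i p i * h i.
Proof.
move=> p0 p1 dp ah; rewrite -lerBrDl.
have -> : \sum_i p i * h i - a = \sum_i p i * (h i - a).
  under [RHS]eq_bigr => i _ do rewrite mulrBr.
  by rewrite sumrB -mulr_suml p1 mul1r.
rewrite (bigD1 i0)//= -[leLHS]addr0 lerD//.
  by rewrite ler_wpM2r// subr_ge0.
by rewrite sumr_ge0// => i _; rewrite mulr_ge0// subr_ge0.
Qed.

Lemma weighted_mean_le (R : realDomainType) (I : finType) (p h : I -> R)
    (i0 : I) (d b : R) :
  (forall i, 0 <= p i) -> \sum_i p i = 1 -> d <= p i0 ->
  (forall i, h i <= b) -> \sum_i p i * h i <= b - d * (b - h i0).
Proof.
move=> p0 p1 dp hb.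
have Nhb i : - b <= - h i by rewrite lerN2.
have := weighted_mean_ge p0 p1 dp Nhb.
rewrite (eq_bigr (fun i => - (p i * h i))); last by move=> i _; rewrite mulrN.
by rewrite sumrN; lra.
Qed.

(* A family of averages of one another, whose weights over one unit of time
   are bounded below, becomes constant: each bracket [a, b] of its values
   shrinks by a factor 1 - d per unit of time. *)
Lemma averaging_flow_cvg (R : realType) (I : finType) (i0 : I)
    (h : R -> I -> R) (p : R -> I -> I -> R) (d : R) :
  0 < d <= 1 ->
  (forall y i j, 0 <= y -> 0 <= p y i j) ->
  (forall y i, \sum_j p y i j = 1) ->
  (forall i j, d <= p 1 i j) ->
  (forall x y i, h (x + y) i = \sum_j p y i j * h x j) ->
  exists c : R, forall i, h x i @[x --> +oo] --> c.
Proof.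
move=> /andP[d0 d1] p0 p1 pd hp.
have [a0 a0h] : exists a0, forall i, a0 <= h 0 i.
  exists (- \sum_i `|h 0 i|) => i.
  rewrite lerNl (le_trans (ler_norm _))// normrN (bigD1 i)//= lerDl.
  exact: sumr_ge0.
have [b0 hb0] : exists b0, forall i, h 0 i <= b0.
  exists (\sum_i `|h 0 i|) => i.
  by rewrite (le_trans (ler_norm _))// (bigD1 i)//= lerDl sumr_ge0.
(* Both ends move by d times their distance to the same value of h at [i0]; the two moves add up to
   d (b - a) whatever that value is. *)
pose fix a n := if n is m.+1 then a m + d * (h m%:R i0 - a m) else a0.
pose fix b n := if n is m.+1 then b m - d * (b m - h m%:R i0) else b0.
have ab n : forall i, a n <= h n%:R i <= b n.
  elim: n => [|n IHn] i /=; first by rewrite a0h hb0.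
  rewrite -natr1 hp weighted_mean_ge ?weighted_mean_le//=.
  - by move=> j; exact: p0.
  - by move=> j; case/andP: (IHn j).
  - by move=> j; exact: p0.
  - by move=> j; case/andP: (IHn j).
(* At any later time, integer or not, the mean inequalities with d = 0 keep the averages inside the
   n-th bracket. *)
have abh n x i : n%:R <= x -> a n <= h x i <= b n.
  rewrite -subr_ge0 => nx; rewrite -(subrKC n%:R x) hp.
  have q0 j : 0 <= p (x - n%:R) i j by exact: p0.
  have q1 := p1 (x - n%:R) i.
  have [an hn] : (forall j, a n <= h n%:R j) /\ (forall j, h n%:R j <= b n).
    by split=> j; case/andP: (ab n j).
  have := weighted_mean_ge q0 q1 (q0 i0) an.
  have := weighted_mean_le q0 q1 (q0 i0) hn.
  by rewrite !mul0r addr0 subr0 => -> ->.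
have ba n : b n - a n = (1 - d) ^+ n * (b0 - a0).
  elim: n => [|n IHn] /=; first by rewrite expr0 mul1r.
  by rewrite exprS -mulrA -IHn; ring.
have a_nd : {homo a : n m / (n <= m)%N >-> n <= m}.
  apply/nondecreasing_seqP => n /=; rewrite lerDl mulr_ge0// ?(ltW d0)//.
  by rewrite subr_ge0; case/andP: (ab n i0).
have b_ni : {homo b : n m / (n <= m)%N >-> n >= m}.
  apply/nonincreasing_seqP => n /=; rewrite gerBl mulr_ge0// ?(ltW d0)//.
  by rewrite subr_ge0; case/andP: (ab n i0).
have a_le_b n m : a n <= b m.
  have := ab (maxn n m) i0 => /andP[ah hb].
  apply: (le_trans (a_nd _ _ (leq_maxl n m))).
  by apply: (le_trans ah); apply: (le_trans hb); apply/b_ni/leq_maxr.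
have ca : cvgn a.
  apply: nondecreasing_is_cvgn => //; exists b0 => _ [n _ <-].
  exact: (a_le_b n 0%N).
exists (limn a) => i; apply/cvgrPdist_lt => e e0.
have a_lim n : a n <= limn a by exact: nondecreasing_cvgn_le.
have lim_b n : limn a <= b n by apply: limr_le => //; near=> m; exact: a_le_b.
have [n ben] : exists n, b n - a n < e.
  have d10 : `|1 - d| < 1 by rewrite ger0_norm ?subr_ge0// gtrBl.
  have /cvgrPdist_lt /(_ _ e0) [n _ H] : b n - a n @[n --> \oo] --> 0.
    under eq_fun do rewrite ba.
    rewrite -(mul0r (b0 - a0)); apply: cvgMr_tmp; exact: cvg_expr.
  exists n; have := H n (leqnn _).
  by rewrite sub0r normrN; exact/le_lt_trans/ler_norm.
near=> x; have /andP[ah hb] : a n <= h x i <= b n.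
  by apply: abh; near: x; exact: nbhs_pinfty_ge.
have := a_lim n; have := lim_b n => cb ac.
by rewrite (le_lt_trans _ ben)// ler_norml; apply/andP; split; lra.
Unshelve. all: by end_near. Qed.

(** Conjugation by f and the factor e^(-gx) turn the flow into a stochastic semigroup, whose rows
    sum to 1 because f is an eigenvector. Positivity of e^B gives the uniform lower bound on the
    weights at time 1. *)
Lemma expmx_doob_cvg (R : realType) (n : nat) (i0 : 'I_n) (B : 'M[R]_n)
    (f v : 'cV[R]_n) (g : R) :
  (forall i, 0 < f i 0) -> B *m f = g *: f ->
  (forall x i j, 0 <= x -> 0 <= expmx (x *: B) i j) ->
  (forall i j, 0 < expmx (1 *: B) i j) ->
  exists c : R, forall i,
    expR (- (g * x)) * (expmx (x *: B) *m v) i 0 / f i 0 @[x --> +oo] --> c.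
Proof.
move=> f0 Bf E0 E1.
pose p (x : R) i j := expR (- (g * x)) * expmx (x *: B) i j * f j 0 / f i 0.
have [d d01 dp] : exists2 d, 0 < d <= 1 &
    forall ij : 'I_n * 'I_n, d <= p 1 ij.1 ij.2.
  by apply: pos_finfun_lbound => ij; rewrite /p divr_gt0// !mulr_gt0 ?expR_gt0.
apply: (@averaging_flow_cvg _ _ i0 _ p d) => //.
- by move=> y i j y0; rewrite /p divr_ge0 ?mulr_ge0 ?expR_ge0 ?E0// ltW.
- move=> y i; rewrite /p -mulr_suml.
  under eq_bigr => j _ do rewrite -mulrA.
  rewrite -mulr_sumr.
  have /matrixP /(_ i 0) := expmx_eigen Bf y; rewrite !mxE => ->.
  by rewrite !mulrA expRN mulVf ?gt_eqF ?expR_gt0// mul1r divff// gt_eqF.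
- by move=> i j; exact: (dp (i, j)).
- move=> x y i; rewrite addrC expmxD -mulmxA mxE mulr_sumr mulr_suml.
  apply: eq_bigr => j _; rewrite /p mulrDr opprD expRD.
  by field; rewrite !gt_eqF.
Qed.

Lemma cvgr_unique (R : realType) (T : Type) (F : set_system T) (f : T -> R)
    {FF : ProperFilter F} (a b : R) :
  f x @[x --> F] --> a -> f x @[x --> F] --> b -> a = b.
Proof.
by move=> fa fb; rewrite -(cvg_lim _ fa)//; exact: (cvg_lim _ fb).
Qed.

(** * Spectral consequences of the convergence *)

Section positive_flow.
Variables (R : realType) (n : nat) (i0 : 'I_n) (B : 'M[R]_n) (f : 'cV[R]_n).
Variable g : R.
Hypotheses (f0 : forall i, 0 < f i 0) (Bf : B *m f = g *: f).
Hypothesis E0 : forall x i j, 0 <= x -> 0 <= expmx (x *: B) i j.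
Hypothesis E1 : forall i j, 0 < expmx (1 *: B) i j.

(* The flow of such a v is e^(g x) (v + c x f), so that its Doob transform
   v_i / f_i + c x can converge only if c = 0, to a limit which is v_i / f_i
   for all i. *)
Lemma positive_flow_jordan (v : 'cV[R]_n) (c : R) :
  B *m v = g *: v + c *: f -> c = 0 /\ exists k, v = k *: f.
Proof.
move=> Bv; have [k] := expmx_doob_cvg i0 v f0 Bf E0 E1.
have hE i : (fun x => expR (- (g * x)) * (expmx (x *: B) *m v) i 0 / f i 0)
    = (fun x => v i 0 / f i 0 + c * x).
  apply/funext => x; rewrite (expmx_jordan Bf Bv) !mxE mulrA expRN mulVf.
    by rewrite mul1r; field; rewrite gt_eqF.
  by rewrite gt_eqF// expR_gt0.
move=> kcvg; have {}kcvg i : v i 0 / f i 0 + c * x @[x --> +oo] --> k.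
  by have := kcvg i; rewrite hE.
(* Shifting time by 1 keeps the limit but changes the function by c. *)
have c0 : c = 0.
  have kcvg1 : v i0 0 / f i0 0 + c * (x + 1) @[x --> +oo] --> k.
    exact: (cvg_comp _ _ (cvg_addrr 1) (kcvg i0)).
  rewrite -(subrr k); apply: (cvgr_unique _ (cvgB kcvg1 (kcvg i0))).
  by apply: cvg_near_cst; apply: nearW => x; rewrite !fctE; ring.
split => //; exists k; apply/matrixP => i j; rewrite ord1 mxE.
have := kcvg i; rewrite c0; under eq_cvg do rewrite mul0r addr0.
move=> /cvgr_unique - /(_ _ (cvg_cst _)) ->.
by rewrite divfK// gt_eqF.
Qed.

(** If m > g, the transform of v is e^((m-g)x) v_i / f_i, which can converge for all i only when v
    vanishes. *)
Lemma positive_flow_eigen_le (v : 'cV[R]_n) (m : R) :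
  v != 0 -> B *m v = m *: v -> m <= g.
Proof.
move=> vn0 Bv; rewrite leNgt; apply/negP => gm.
have [k] := expmx_doob_cvg i0 v f0 Bf E0 E1.
have hE i : (fun x => expR (- (g * x)) * (expmx (x *: B) *m v) i 0 / f i 0)
    = (fun x => expR ((m - g) * x) * (v i 0 / f i 0)).
  apply/funext => x; rewrite (expmx_eigen Bv) !mxE mulrA -expRD.
  by rewrite mulrA mulrBl addrC.
move=> kcvg; have {}kcvg i :
    expR ((m - g) * x) * (v i 0 / f i 0) @[x --> +oo] --> k.
  by have := kcvg i; rewrite hE.
(* The limit is invariant under a time shift by 1, which multiplies the function by e^(m-g),
   different from 1. *)
have k0 : k = 0.
  have kcvg1 : expR ((m - g) * (x + 1)) * (v i0 0 / f i0 0) @[x --> +oo] --> k.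
    exact: (cvg_comp _ _ (cvg_addrr 1) (kcvg i0)).
  have kcvg2 : expR ((m - g) * (x + 1)) * (v i0 0 / f i0 0) @[x --> +oo]
      --> expR (m - g) * k.
    under eq_cvg do rewrite mulrDr mulr1 expRD mulrAC mulrC.
    exact: cvgMl_tmp.
  have kE : k = expR (m - g) * k := cvgr_unique kcvg1 kcvg2.
  have /eqP : (1 - expR (m - g)) * k = 0 by rewrite mulrBl mul1r -kE subrr.
  rewrite mulf_eq0 => /orP[|/eqP//].
  rewrite subr_eq0 -expR0 => /eqP/expR_inj/esym/eqP.
  by rewrite subr_eq0 gt_eqF.
move/eqP: vn0; apply; apply/matrixP => i j; rewrite ord1 mxE.
suff: v i 0 / f i 0 = 0.
  by move/eqP; rewrite mulf_eq0 invr_eq0 (gt_eqF (f0 i)) orbF => /eqP.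
apply/eqP; rewrite -normr_le0.
(* For x >= 0 the exponential factor is at least 1, so the absolute value stays above |v_i / f_i|
   and its zero limit forces v_i = 0. *)
have := cvg_norm (kcvg i); rewrite k0 normr0 => kn.
apply: (cvgr_to_ge (kn _)); near=> x.
rewrite [leRHS]normrM ler_peMl// ger0_norm ?expR_ge0//.
by rewrite -expR0 ler_expR mulr_ge0 ?subr_ge0 ?(ltW gm).
Unshelve. all: by end_near. Qed.

(** The nonnegative flow preserves a f <= v, and it acts on f as multiplication by e^(gx). Applied
    to the terminal vector, this keeps the transform and its limit away from zero. *)
Lemma positive_flow_ge (v : 'cV[R]_n) (a x : R) (i : 'I_n) : 0 <= x ->
  (forall i, a * f i 0 <= v i 0) ->
  a <= expR (- (g * x)) * (expmx (x *: B) *m v) i 0 / f i 0.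
Proof.
move=> x0 av; rewrite ler_pdivlMr// expRN [leRHS]mulrC ler_pdivlMr ?expR_gt0//.
have /matrixP /(_ i 0) := expmx_eigen Bf x; rewrite !mxE => fE.
rewrite -mulrA [f i 0 * _]mulrC -fE mulr_sumr.
by apply: ler_sum => j _; rewrite mulrCA ler_wpM2l// E0.
Qed.

(* With S obtained from the identity by putting f in column i0, the matrix (X
   - B) S is M diag(1, .., X - g, .., 1), where M is X - B with f in column
   i0; a kernel vector of M at g would give a Jordan chain above f. *)
Lemma positive_flow_mup_char_poly : mup g (char_poly B) = 1%N.
Proof.
pose S : 'M[R]_n := \matrix_(i, j) if j == i0 then f i 0 else (i == j)%:R.
pose M := \matrix_(i, j) if j == i0 then (f i 0)%:P else char_poly_mx B i j.
pose d := \row_j (if j == i0 then 'X - g%:P else 1).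
have SM : char_poly_mx B *m map_mx polyC S = M *m diag_mx d.
  rewrite mul_mx_diag; apply/matrixP => i j; rewrite !mxE.
  case: eqP => [->|/eqP ji].
    under eq_bigr => k _ do rewrite !mxE eqxx mulrBl -polyCM.
    rewrite sumrB (bigD1 i)//= eqxx mulr1n big1 ?addr0; last first.
      by move=> k ki; rewrite eq_sym (negbTE ki) mulr0n mul0r.
    rewrite -raddf_sum/=; have /matrixP /(_ i 0) := Bf; rewrite !mxE => ->.
    by rewrite polyCM; ring.
  rewrite mulr1 (bigD1 j)//= big1 ?addr0.
    by rewrite !mxE (negbTE ji) eqxx mulr1.
  by move=> k kj; rewrite !mxE (negbTE ji) (negbTE kj) mulr0.
have detd : \det (diag_mx d) = 'X - g%:P.
  rewrite det_diag (bigD1 i0)//= big1 ?mulr1 ?mxE ?eqxx//.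
  by move=> j ji; rewrite mxE (negbTE ji).
(* Row [i0] of S has f_i0 as its only nonzero entry, so a kernel vector vanishes at [i0]; the other
   rows then annihilate its remaining coordinates. *)
have S0 : \det S != 0.
  rewrite -det_tr; apply/det0P => -[u /negP u0 uS]; apply: u0; apply/eqP.
  have uSi i : \sum_j u 0 j * S i j = 0.
    move/matrixP: uS => /(_ 0 i); rewrite !mxE => uSi.
    by rewrite -[RHS]uSi; apply: eq_bigr => j _; rewrite !mxE.
  have ui0 : u 0 i0 = 0.
    have := uSi i0; rewrite (bigD1 i0)//= big1 ?addr0 => [|j ji].
      rewrite mxE eqxx => /eqP; rewrite mulf_eq0 (gt_eqF (f0 _)) orbF.
      by move/eqP.
    by rewrite mxE (negbTE ji) eq_sym (negbTE ji) mulr0.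
  apply/rowP => i; rewrite mxE; have [->//|ii0] := eqVneq i i0.
  have := uSi i; rewrite (bigD1 i)//= big1 ?addr0 => [|j ji].
    by rewrite mxE (negbTE ii0) eqxx mulr1.
  rewrite mxE; case: eqP => [->|_]; first by rewrite ui0 mul0r.
  by rewrite eq_sym (negbTE ji) mulr0.
(* A kernel vector u of M at g satisfies B v = g v + u_i0 f, where v is u with coordinate [i0] set
   to 0. The Jordan lemma gives u_i0 = 0 and v = k f, and v_i0 = 0 makes k = 0. *)
have M0 : ~~ root (\det M) g.
  rewrite /root -horner_evalE -det_map_mx -det_tr; apply/det0P.
  move=> [u /negP u0 uM]; apply: u0; apply/eqP.
  pose v : 'cV[R]_n := \col_j if j == i0 then 0 else u 0 j.
  have [u00 [k vk]] : u 0 i0 = 0 /\ exists k, v = k *: f.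
    apply: positive_flow_jordan; apply/matrixP => i j; rewrite ord1.
    move/matrixP: uM => /(_ 0 i); rewrite !mxE.
    rewrite (bigD1 i0)//= !mxE eqxx /= horner_evalE hornerC => uM.
    rewrite (bigD1 i0)//= !mxE eqxx mulr0 add0r.
    move/eqP: uM; rewrite addr_eq0 => /eqP ->.
    apply/esym/eqP; rewrite subr_eq -big_split/=; apply/eqP/esym.
    have [->|ii0] := eqVneq i i0.
      rewrite mulr0 big1// => l li; rewrite !mxE (negbTE li).
      rewrite horner_evalE eq_sym (negbTE li) mulr0n sub0r hornerN hornerC.
      by ring.
    rewrite (bigD1 i)//= big1 ?addr0 => [|l /andP[li0 li]].
      rewrite !mxE (negbTE ii0) horner_evalE eqxx mulr1n.
      rewrite hornerD hornerN hornerC hornerX.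
      by ring.
    rewrite !mxE (negbTE li0) horner_evalE eq_sym (negbTE li) mulr0n sub0r.
    by rewrite hornerN hornerC; ring.
  have v0 : v = 0.
    rewrite vk; have /matrixP /(_ i0 0) := vk; rewrite !mxE eqxx => /esym/eqP.
    by rewrite mulf_eq0 (gt_eqF (f0 _)) orbF => /eqP ->; rewrite scale0r.
  apply/rowP => i; rewrite mxE; have [->//|ii0] := eqVneq i i0.
  by move/matrixP: v0 => /(_ i 0); rewrite !mxE (negbTE ii0).
have detM0 : \det M != 0 by apply: contraNneq M0 => ->; exact: root0.
(* In the product formula det S is a nonzero constant and det M has no root at g, so the
   multiplicity comes from X - g alone. *)
have := congr1 (mup g) (congr1 determinant SM).
rewrite !det_mulmx det_map_mx detd mupMl ?rootC// => ->.
by rewrite mupMr// -['X - _]expr1 mup_XsubCX eqxx.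
Qed.

End positive_flow.

(** * Perron eigenvectors *)

(* The Collatz-Wielandt argument: f is a maximiser of the l such that l x <=
   A x for some x in the simplex. *)
Lemma perron_vector (R : realType) (n : nat) (i0 : 'I_n) (A Q : 'M[R]_n) :
  (forall i j, 0 <= A i j) -> (forall i j, 0 < Q i j) -> A *m Q = Q *m A ->
  exists (f : 'cV[R]_n) (r : R), (forall i, 0 < f i 0) /\ A *m f = r *: f.
Proof.
move=> A0 Q0 AQ.
(* Bounds every feasible l: sum the inequalities l x_i <= (A x)_i, where x sums to 1 and has
   coordinates at most 1. The feasible set [Z] is therefore compact. *)
pose C := \sum_i \sum_j A i j.
pose slack (z : 'rV[R]_n * R) i := \sum_j A i j * z.1 0 j - z.2 * z.1 0 i.
pose box : set ('rV[R]_n * R) :=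
  [set x : 'rV[R]_n | forall i, `[0, 1]%classic (x ord0 i)] `*` `[0, C].
pose Z := (box `&`
    (fun z : 'rV[R]_n * R => \sum_i z.1 0 i) @^-1` [set x | x = 1])
  `&` \bigcap_i (slack^~ i @^-1` [set x | 0 <= x]).
have cont_coord i : continuous (fun z : 'rV[R]_n * R => z.1 0 i).
  move=> z; apply: (@continuous_comp _ _ _ fst (fun x : 'rV[R]_n => x 0 i)).
    exact: cvg_fst.
  exact: coord_continuous.
have cZ : compact Z.
  have cbox : compact box.
    apply: compact_setX; last exact: segment_compact.
    apply: (@rV_compact R n (fun=> `[0, 1]%classic)) => _.
    exact: segment_compact.
  rewrite /Z -setIA; apply: compact_closedI => //; apply: closedI.
    apply: preimage_closed; last exact: closed_eq.
    have : continuous (fun z : 'rV[R]_n * R => \sum_i z.1 0 i).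
      by apply: continuous_big => [|i _]; [exact: add_continuous|].
    by move=> c z _; exact: c.
  apply: closed_bigI => i _; apply: preimage_closed; last exact: closed_ge.
  have cA : continuous (fun z : 'rV[R]_n * R => \sum_j A i j * z.1 0 j).
    apply: continuous_big => [|j _]; first exact: add_continuous.
    by move=> z; apply: cvgMl_tmp; exact: cont_coord.
  move=> z _; apply: cvgB; first exact: cA.
  by apply: cvgM; [exact: cvg_snd|exact: cont_coord].
have Zbound (x : 'rV[R]_n) (l : R) : (forall i, 0 <= x 0 i) ->
    \sum_i x 0 i = 1 -> 0 <= l ->
    (forall i, l * x 0 i <= \sum_j A i j * x 0 j) -> Z (x, l).
  move=> x0 x1 l0 lx.
  have x_le1 i : x 0 i <= 1 by rewrite -x1 (bigD1 i)//= lerDl sumr_ge0.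
  split; last by move=> i _; rewrite /slack /= subr_ge0.
  split=> //; split=> /=; first by move=> i; rewrite /= in_itv/= x0 x_le1.
  rewrite in_itv/= l0 -[leLHS]mulr1 -x1 mulr_sumr ler_sum// => i _.
  apply: (le_trans (lx i)); apply: ler_sum => j _.
  by rewrite ler_piMr.
have Z0 : Z !=set0.
  exists (delta_mx 0 i0, 0); apply: Zbound => // [i||i].
  - by rewrite mxE.
  - rewrite (bigD1 i0)//= big1 ?mxE ?eqxx ?addr0// => j ji.
    by rewrite mxE (negbTE ji).
  - by rewrite mul0r sumr_ge0// => j _; rewrite mulr_ge0// mxE.
have [|[x r] /set_mem Zxr xrmax] := @compact_EVT_max _ _ snd Z Z0 cZ.
  by apply: continuous_subspaceT => z; exact: cvg_snd.
have [[[xbox /= rbox] x1] rx] := Zxr.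
have x0 i : 0 <= x 0 i by have := xbox i; rewrite /= in_itv/= => /andP[].
have r0 : 0 <= r by move: rbox; rewrite /= in_itv/= => /andP[].
have {}rx i : r * x 0 i <= \sum_j A i j * x 0 j.
  by have := rx i I; rewrite /slack /= subr_ge0.
(* As Q is positive and commutes with A, one has A f - r f = Q y with y >= 0; a nonzero y would make
   every entry positive, and r could be increased. *)
pose f := Q *m x^T; pose y := A *m x^T - r *: x^T.
have Qpos (v : 'cV[R]_n) : (forall i, 0 <= v i 0) -> v != 0 ->
    forall i, 0 < (Q *m v) i 0.
  move=> v0 vn0 i; have [k vk] : exists k, v k 0 != 0.
    apply/existsP; apply: contra_neqT vn0; rewrite negb_exists => /forallP vE.
    by apply/matrixP => k j; rewrite ord1 mxE; apply/eqP/negPn/vE.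
  rewrite mxE (bigD1 k)//= ltr_pwDl ?mulr_gt0// ?lt0r ?vk ?v0//.
  by rewrite sumr_ge0// => j _; rewrite mulr_ge0// ltW.
have fpos : forall i, 0 < f i 0.
  apply: Qpos => [i|]; first by rewrite mxE.
  apply/eqP => xT0; have : \sum_i x 0 i = 0.
    by rewrite big1// => i _; have /matrixP /(_ i 0) := xT0; rewrite !mxE.
  by move/eqP; rewrite x1 oner_eq0.
have Ay : A *m f - r *: f = Q *m y.
  by rewrite /y mulmxBr -scalemxAr mulmxA AQ -mulmxA.
exists f, r; split => //; apply/eqP; rewrite -subr_eq0 Ay.
have [->|yn0] := eqVneq y 0; first by rewrite mulmx0.
exfalso.
have Qy : forall i, 0 < (Q *m y) i 0.
  apply: Qpos => // i; rewrite !mxE subr_ge0.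
  by have := rx i; under [X in _ -> _ <= X]eq_bigr => j _ do rewrite mxE.
(* [e] is the room left: the normalised f is feasible with r + e, against the maximality of r. *)
have [e /andP[e0 _] eP] : exists2 e : R, 0 < e <= 1 &
    forall i, e <= (Q *m y) i 0 / f i 0.
  by apply: pos_finfun_lbound => i; rewrite divr_gt0.
pose s := \sum_i f i 0.
have s0 : 0 < s.
  by rewrite /s (bigD1 i0)//= ltr_pwDl// sumr_ge0// => i _; rewrite ltW.
have sf i : (s^-1 *: f^T) 0 i = s^-1 * f i 0 by rewrite mxE [f^T _ _]mxE.
have /xrmax : (s^-1 *: f^T, r + e) \in Z.
  apply/mem_set/Zbound => [i|||i].
  - by rewrite sf mulr_ge0 ?invr_ge0 ?(ltW s0) ?(ltW (fpos i)).
  - under eq_bigr => i _ do rewrite sf.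
    by rewrite -mulr_sumr mulVf ?gt_eqF.
  - by rewrite addr_ge0 ?(ltW e0).
  - have AfB (u w : 'cV[R]_n) : (u - r *: w) i 0 = u i 0 - r * w i 0.
      by rewrite !mxE.
    have := eP i; rewrite ler_pdivlMr// -Ay AfB [(A *m f) i 0]mxE sf mulrCA.
    move=> efi.
    under eq_bigr => j _ do rewrite sf mulrCA.
    by rewrite -mulr_sumr ler_pM2l ?invr_gt0// mulrDl; move: efi; lra.
by rewrite /= gerDl leNgt e0.
Qed.

Section irreducible_metzler.
Variables (R : realType) (n : nat) (B : 'M[R]_n).
Hypothesis B0 : forall i j, i != j -> 0 <= B i j.
Hypothesis Bconn : forall i j, exists2 p, path (fun a b => 0 < B a b) i p
  & last i p = j.

(** A shift large enough to make the diagonal nonnegative. It changes the flow by a positive scalar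
    factor only, so signs can be read on the nonnegative matrix [A]. *)
Let c : R := \sum_i `|B i i|.
Let A := B + c%:M.

Let c0 : 0 <= c. Proof. exact: sumr_ge0. Qed.

Let A0 i j : 0 <= A i j.
Proof.
rewrite !mxE; have [<-|ij] := eqVneq i j; last by rewrite addr0 B0.
rewrite mulr1n -lerBlDl sub0r (le_trans (ler_norm _))// normrN.
by rewrite /c (bigD1 i)//= lerDl sumr_ge0.
Qed.

Let expmxB x : expmx (x *: B) = expR (- (c * x)) *: expmx (x *: A).
Proof. by rewrite expmxD_scalar scalerA -expRD addNr expR0 scale1r. Qed.

Lemma metzler_expmx_ge0 x i j : 0 <= x -> 0 <= expmx (x *: B) i j.
Proof.
move=> x0; rewrite expmxB mxE mulr_ge0 ?expR_ge0//.
apply: le_trans (expmx_ge 0 i j A0 x0).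
by rewrite expr0 mxE !mulr_ge0 ?invr_ge0.
Qed.

(** A walk of k edges from i to j makes the (i, j) entry of A^k positive, and this one term bounds
    the exponential from below. *)
Let expmxA_gt0 i j : 0 < expmx (1 *: A) i j.
Proof.
have [p ip <-] := Bconn i j.
apply: lt_le_trans (expmx_ge (size p) i _ A0 ler01).
rewrite expr1n mulr1 mulr_gt0 ?invr_gt0 ?ltr0n ?fact_gt0//.
elim: p i ip => [|k p IHp] i /=; first by rewrite expr0 mxE eqxx.
move=> /andP[ik kp]; rewrite exprS -mulmxE mxE (bigD1 k)//= ltr_pwDl//.
  by rewrite mulr_gt0 ?IHp// !mxE ltr_wpDr// mulrn_wge0.
rewrite sumr_ge0// => l _; rewrite mulr_ge0//.
elim: (size p) (last k p) l => [|m IHm] a b; first by rewrite expr0 mxE.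
by rewrite exprS -mulmxE mxE sumr_ge0// => a' _; rewrite mulr_ge0.
Qed.

Lemma metzler_expmx_gt0 i j : 0 < expmx (1 *: B) i j.
Proof. by rewrite expmxB mxE mulr_gt0 ?expR_gt0. Qed.

(** The positive matrix commuting with [A] is e^A; the eigenvalue is then shifted back by c. *)
Lemma metzler_perron (i0 : 'I_n) :
  exists (f : 'cV[R]_n) (g : R), (forall i, 0 < f i 0) /\ B *m f = g *: f.
Proof.
have [f [r [f0 Af]]] := perron_vector i0 A0 expmxA_gt0 (expmx_comm A 1).
exists f, (r - c); split => //.
by rewrite scalerBl -Af mulmxDl mul_scalar_mx addrK.
Qed.

End irreducible_metzler.

(** * Integration *)

Local Open Scope ereal_scope.

(* No measurability is needed: the integral of a nonnegative function is a
   supremum over the simple functions below it. *)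
Lemma le_integral_nonmeasurable d (T : measurableType d) (R : realType)
    (mu : {measure set T -> \bar R}) (D : set T) (f g : T -> \bar R) :
  (forall x, D x -> f x <= g x) ->
  \int[mu]_(x in D) f x <= \int[mu]_(x in D) g x.
Proof.
have ge0_le (h k : T -> \bar R) : (forall x, 0 <= h x) ->
    (forall x, 0 <= k x) -> (forall x, D x -> h x <= k x) ->
    \int[mu]_(x in D) h x <= \int[mu]_(x in D) k x.
  move=> h0 k0 hk; rewrite !ge0_integralE//; apply: le_ereal_sup.
  move=> _ [s /= sh <-]; exists s => //= x; apply: (le_trans (sh x)).
  by apply: lee_restrict.
move=> fg; rewrite [leLHS]integralE [leRHS]integralE.
apply: leeB; apply: ge0_le => // x Dx.
  by apply: (funepos_le (D := D)); rewrite ?inE// => y /set_mem; exact: fg.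
by apply: (funeneg_le (D := D)); rewrite ?inE// => y /set_mem; exact: fg.
Qed.

(** Tonelli: the iterated integral of |f| is at most the product of the integrals of |h| and |k|,
    both finite. *)
Lemma dominated_product_integrable d1 d2 (T1 : measurableType d1)
    (T2 : measurableType d2) (R : realType)
    (m1 : {sigma_finite_measure set T1 -> \bar R})
    (m2 : {sigma_finite_measure set T2 -> \bar R})
    (f : T1 * T2 -> R) (h : T1 -> R) (k : T2 -> R) :
  measurable_fun setT f ->
  m1.-integrable setT (EFin \o h) -> m2.-integrable setT (EFin \o k) ->
  (forall x y, `|f (x, y)| <= h x * k y)%R ->
  (m1 \x m2).-integrable setT (EFin \o f).
Proof.
move=> mf ih ik fhk; apply/integrable12ltyP; first exact/measurable_EFinP.
apply: (@le_lt_trans _ _ (\int[m1]_x `|(h x)%:E| * \int[m2]_y `|(k y)%:E|)).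
  rewrite -ge0_integralZr //.
  - apply: le_integral_nonmeasurable => x _.
    rewrite -ge0_integralZl//; last exact/measurableT_comp/measurable_int/ik.
    apply: le_integral_nonmeasurable => y _; rewrite -abseM lee_fin.
    exact: (le_trans (fhk x y) (ler_norm _)).
  - exact/measurableT_comp/measurable_int/ih.
  - exact: integral_ge0.
have /integrableP[_ hoo] := ih; have /integrableP[_ koo] := ik.
by apply: lte_mul_pinfty => //; rewrite ?ge0_fin_numE ?integral_ge0.
Qed.

Lemma integrable_fubini_G d1 d2 (T1 : measurableType d1)
    (T2 : measurableType d2) (R : realType)
    (m1 : {sigma_finite_measure set T1 -> \bar R})
    (m2 : {sigma_finite_measure set T2 -> \bar R}) (f : T1 * T2 -> \bar R) :
  (m1 \x m2).-integrable setT f -> m2.-integrable setT (fubini_G m1 f).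
Proof.
move=> fi; have mf := measurable_int _ fi.
apply/integrableP; split; first exact: (measurable_fubini_G fi).
apply: le_lt_trans (proj1 (@integrable21ltyP _ _ _ _ _ m1 m2 _ mf) fi).
apply: le_integral_nonmeasurable => y _.
apply: le_abse_integral => //.
exact: (measurableT_comp mf (pair2_measurable y)).
Qed.

Lemma Rintegral_EFin d (T : measurableType d) (R : realType)
    (mu : {measure set T -> \bar R}) (D : set T) (f : T -> R) :
  measurable D -> mu.-integrable D (EFin \o f) ->
  \int[mu]_(x in D) (f x)%:E = (Rintegral mu D f)%:E.
Proof.
by move=> mD fi; rewrite /Rintegral fineK//; exact: (integrable_fin_num mD fi).
Qed.

Local Close Scope ereal_scope.

(* M and v are absolutely continuous, with densities a and v': the formula is
   Fubini's theorem for a x * v' y on the triangle x <= y. *)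
Lemma Rintegration_by_parts_ac (R : realType) (t T : R) (a M v v' : R -> R) :
  t <= T ->
  (@lebesgue_measure R).-integrable `[t, T] (EFin \o a) ->
  (@lebesgue_measure R).-integrable `[t, T] (EFin \o v') ->
  (forall y, t <= y <= T ->
    M y - M t = \int[@lebesgue_measure R]_(x in `[t, y]) a x) ->
  (forall x, t <= x <= T ->
    v T - v x = \int[@lebesgue_measure R]_(y in `[x, T]) v' y) ->
  (@lebesgue_measure R).-integrable `[t, T]
    (EFin \o (fun x => a x * v x + M x * v' x)) /\
  \int[@lebesgue_measure R]_(x in `[t, T]) (a x * v x + M x * v' x) =
    M T * v T - M t * v t.
Proof.
move=> tT ia iv HM Hv.
pose mu := @lebesgue_measure R.
pose D : set (measurableTypeR R) := `[t, T]%classic.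
have mD : measurable D by exact: measurable_itv.
pose a0 := a \_ D; pose v0 := v' \_ D.
have ia0 : mu.-integrable setT (EFin \o a0).
  rewrite /a0 -restrict_EFin; exact: (proj1 (integrable_mkcond _ mD) ia).
have iv0 : mu.-integrable setT (EFin \o v0).
  rewrite /v0 -restrict_EFin; exact: (proj1 (integrable_mkcond _ mD) iv).
pose E : set (measurableTypeR R * measurableTypeR R) := [set z | z.1 <= z.2].
have mE : measurable E.
  rewrite -[E]setTI; apply: (@measurable_fun_ler _ _ _ setT fst snd) => //.
pose f (z : measurableTypeR R * measurableTypeR R) := a0 z.1 * v0 z.2 * \1_E z.
have mf : measurable_fun setT f.
  apply: measurable_funM; last exact: measurable_indic.
  apply: measurable_funM.
    by apply: measurableT_comp => //; apply/measurable_EFinP/measurable_int/ia0.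
  by apply: measurableT_comp => //; apply/measurable_EFinP/measurable_int/iv0.
have if_ : (mu \x mu)%E.-integrable setT (EFin \o f).
  apply: (@dominated_product_integrable _ _ _ _ _ _ _ _
    (fun x => `|a0 x|) (fun y => `|v0 y|)) => //.
  - exact: integrable_norm.
  - exact: integrable_norm.
  - move=> x y; rewrite /f !normrM/= ler_piMr ?mulr_ge0//.
    by rewrite indicE; case: (_ \in _); rewrite ?normr1 ?normr0.
(* For fixed x the triangle leaves y in [x, T], where v' integrates to v(T) - v(x). For fixed y, in
   [GE], it leaves x in [t, y] and the increment of M. *)
have FE : fubini_F mu (EFin \o f) =
    (EFin \o (fun x => a x * (v T - v x))) \_ D.
  apply/funext => x; rewrite /fubini_F patchE; case: ifPn => xD; last first.
    apply: integral0_eq => y _.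
    by rewrite /= /f /= /a0 patchE (negbTE xD) !mul0r.
  have /andP[tx xT] : t <= x <= T by move/set_mem: xD; rewrite /D /= in_itv.
  have xTD : `[x, T] `<=` D.
    by move=> y; rewrite /D /= !in_itv/= => /andP[/(le_trans tx) -> ->].
  have mx : measurable (`[x, T]%classic : set (measurableTypeR R)).
    exact: measurable_itv.
  have ivx := integrableS mD mx xTD iv.
  rewrite /= Hv ?tx// EFinM -Rintegral_EFin// integral_mkcond -integralZl//;
    last exact: (proj1 (integrable_mkcond _ mx) ivx).
  apply: eq_integral => y _; rewrite /f /= /a0 /v0 !patchE xD indicE.
  have -> : (y \in `[x, T]%classic) = (y \in D) && ((x, y) \in E).
    apply/idP/andP => [/set_mem yx|[/set_mem yD /set_mem xy]]; rewrite ?inE.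
      split; first exact: xTD.
      by move: yx; rewrite /= in_itv/= => /andP[].
    by move: yD xy; rewrite /D /E /= !in_itv/= => /andP[_ ->] ->.
  by case: (y \in D); case: (_ \in E);
    rewrite /= -?EFinM ?mule0 ?mulr0 ?mul0r ?mulr1.
have GE : fubini_G mu (EFin \o f) =
    (EFin \o (fun y => v' y * (M y - M t))) \_ D.
  apply/funext => y; rewrite /fubini_G patchE; case: ifPn => yD; last first.
    apply: integral0_eq => x _.
    by rewrite /= /f /= /v0 patchE (negbTE yD) mulr0 mul0r.
  have /andP[ty yT] : t <= y <= T by move/set_mem: yD; rewrite /D /= in_itv.
  have tyD : `[t, y] `<=` D.
    by move=> x; rewrite /D /= !in_itv/= => /andP[-> /le_trans ->].
  have my : measurable (`[t, y]%classic : set (measurableTypeR R)).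
    exact: measurable_itv.
  have iay := integrableS mD my tyD ia.
  rewrite /= HM ?ty// EFinM -Rintegral_EFin// integral_mkcond -integralZl//;
    last exact: (proj1 (integrable_mkcond _ my) iay).
  apply: eq_integral => x _; rewrite /f /= /a0 /v0 !patchE yD indicE.
  have -> : (x \in `[t, y]%classic) = (x \in D) && ((x, y) \in E).
    apply/idP/andP => [/set_mem yx|[/set_mem yD' /set_mem xy]]; rewrite ?inE.
      split; first exact: tyD.
      by move: yx; rewrite /= in_itv/= => /andP[].
    by move: yD' xy; rewrite /D /E /= !in_itv/= => /andP[-> _] ->.
  by case: (x \in D); case: (_ \in E);
    rewrite /= -?EFinM ?mule0 ?mulr0 ?mul0r ?mulr1 1?mulrC.
have iav : mu.-integrable D (EFin \o (fun x => a x * (v T - v x))).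
  apply: (proj2 (integrable_mkcond _ mD)); rewrite -FE.
  exact: integrable_fubini_F.
have iMv : mu.-integrable D (EFin \o (fun y => v' y * (M y - M t))).
  apply: (proj2 (integrable_mkcond _ mD)); rewrite -GE.
  exact: integrable_fubini_G.
have XE : \int[mu]_(x in D) (a x * (v T - v x)) =
    \int[mu]_(y in D) (v' y * (M y - M t)).
  apply: EFin_inj; rewrite -!Rintegral_EFin//.
  have := Fubini if_; rewrite -[LHS]/(\int[mu]_x fubini_F mu (EFin \o f) x)%E.
  rewrite -[RHS]/(\int[mu]_x fubini_G mu (EFin \o f) x)%E FE GE.
  by rewrite -!integral_mkcond.
have iva : mu.-integrable D (EFin \o (fun x => v T * a x)).
  exact: (@integrableZl _ _ _ mu D mD (v T) _ ia).
have iMtv : mu.-integrable D (EFin \o (fun x => M t * v' x)).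
  exact: (@integrableZl _ _ _ mu D mD (M t) _ iv).
(* In this splitting the two middle integrals cancel by Fubini; what remains is v(T) (M(T) - M(t)) +
   M(t) (v(T) - v(t)). *)
have fE : (fun x => a x * v x + M x * v' x) =
    (fun x => (v T * a x - a x * (v T - v x)) +
              (v' x * (M x - M t) + M t * v' x)).
  by apply/funext => x; ring.
have i1 : mu.-integrable D (EFin \o (fun x => v T * a x - a x * (v T - v x))).
  exact: (integrableB mD iva iav).
have i2 : mu.-integrable D (EFin \o (fun x => v' x * (M x - M t) + M t * v' x)).
  exact: (integrableD mD iMv iMtv).
split; first by rewrite fE; exact: (integrableD mD i1 i2).
rewrite fE RintegralD// RintegralB// RintegralD// !RintegralZl// XE.
rewrite -HM ?lexx ?tT// -Hv ?lexx ?tT//; ring.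
Qed.

(** * Functionals of a continuous-time chain *)

(** For s < T, right-continuity makes X_s = k equivalent to the existence of n such that X_q = k for
    all rational q in ]s, s + 1/(n+1)] within [t, T]. The set [bad n] collects the violations as a
    countable union of rectangles; time T is treated apart. *)
Lemma measurable_right_continuous_process (R : realType) d
    (Omega : measurableType d) (S : eqType) (X : R -> Omega -> S) (t T : R)
    (k : S) :
  t <= T ->
  (forall s, t <= s <= T -> measurable (X s @^-1` [set k])) ->
  (forall w s, t <= s < T -> \forall u \near s^'+, X u w = X s w) ->
  measurable ([set z | t <= z.1 <= T /\ X z.1 z.2 = k]
    : set (measurableTypeR R * Omega)).
Proof.
move=> tT mX rcX.
have ballR (x y e : R) : x < y -> y < x + e -> ball x e y.
  by move=> xy yxe; rewrite /ball/= ltr_norml; apply/andP; split; lra.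
have ltD (x y c e : R) : y - c < x -> c < e -> y < x + e by lra.
pose bad n : set (measurableTypeR R * Omega) := \bigcup_(q in setT : set rat)
  if (t <= ratr q <= T) then
    `]ratr q - n.+1%:R^-1, ratr q[ `*` ~` (X (ratr q) @^-1` [set k]) else set0.
have -> : [set z : measurableTypeR R * Omega | t <= z.1 <= T /\ X z.1 z.2 = k] =
    ([set T] `*` (X T @^-1` [set k])) `|`
    ((`[t, T[ `*` setT) `&` \bigcup_n ~` bad n).
  suff H (s : R) w : (t <= s <= T /\ X s w = k) <->
      (s = T /\ X T w = k) \/
      (((s \in `[t, T[) /\ True) /\ (\bigcup_n ~` bad n) (s, w)).
    by apply/seteqP; split=> -[s w]; [exact: (H s w).1|exact: (H s w).2].
  split.
    move=> [/andP[ts sT] Xsw].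
    have [sTE|sT'] := eqVneq s T; first by left; rewrite -sTE.
    have {}sT' : s < T by rewrite lt_neqAle sT' sT.
    right; split; first by rewrite in_itv/= ts sT'.
    have [|e /= e0 He] := rcX w s; first by rewrite ts sT'.
    have [n] := ltr_add_invr e0; rewrite add0r => ne.
    exists n => // -[q _]; case: ifP => // _ [/=].
    rewrite in_itv/= => /andP[qn sq]; apply; rewrite -Xsw; apply: He => //.
    exact/ballR/(ltD _ _ _ _ qn ne).
  move=> [[-> XT]|[[/[!in_itv]/= /andP[ts sT] _] [n _ nbad]]].
    by rewrite tT lexx.
  rewrite ts (ltW sT); split => //.
  have [|e /= e0 He] := rcX w s; first by rewrite ts sT.
  pose m := Num.min T (Num.min (s + e) (s + n.+1%:R^-1)).
  have /rat_in_itvoo[q] : s < m.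
    by rewrite /m !lt_min sT !ltrDl e0 invr_gt0 ltr0Sn.
  rewrite in_itv/= /m !lt_min => /andP[sq /andP[qT /andP[qe qn]]].
  have -> : X s w = X (ratr q) w.
    by apply/esym/He => //; exact: ballR.
  apply: contrapT => Xq; apply: nbad; exists q => //.
  rewrite (le_trans ts (ltW sq)) (ltW qT)/=; split => //=.
  by rewrite in_itv/= sq andbT ltrBlDr.
apply: measurableU.
  by apply: measurableX => //; apply: mX; rewrite tT lexx.
apply: measurableI; first exact: measurableX.
apply: bigcup_measurable => n _; apply: measurableC.
apply: bigcupT_measurable_rat => q; case: ifP => // tqT.
by apply: measurableX => //; apply: measurableC; exact: mX.
Qed.

Lemma intensity_mx_mul (R : realType) (N : nat) (V : 'I_N -> {set 'I_N})
    (l : 'I_N -> 'I_N -> R) (v : 'I_N -> R) (i : 'I_N) : i \notin V i ->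
  \sum_j intensity_mx V l i j * v j = \sum_(j in V i) l i j * (v j - v i).
Proof.
move=> iV; rewrite (bigID (mem (V i)))/=.
rewrite (eq_bigr (fun j => l i j * v j)); last first.
  by move=> j jV; rewrite mxE jV.
rewrite [X in _ + X](bigD1 i)//= mxE (negbTE iV) eqxx.
rewrite [X in _ + (_ + X)]big1 ?addr0; last first.
  by move=> j /andP[jV ji]; rewrite mxE (negbTE jV) (negbTE ji) mul0r.
rewrite mulNr mulr_suml -sumrB; apply: eq_bigr => j _; ring.
Qed.

Lemma finite_expectation (R : realType) d (Omega : measurableType d)
    (P : probability Omega R) (I : finType) (Y : Omega -> I) (c m : I -> R) :
  (forall k, measurable (Y @^-1` [set k])) ->
  (forall k, P (Y @^-1` [set k]) = (m k)%:E) ->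
  P.-integrable setT (EFin \o (c \o Y)) /\
  (\int[P]_w (c (Y w))%:E)%E = (\sum_k c k * m k)%:E.
Proof.
move=> mY Pm.
have iI k : P.-integrable setT (EFin \o \1_(Y @^-1` [set k])).
  exact: integrable_indic.
have iZ k : P.-integrable setT
    (fun w => (c k)%:E * (EFin \o \1_(Y @^-1` [set k])) w)%E.
  exact: integrableZl.
have cE w : (c (Y w))%:E =
    (\sum_k (c k)%:E * (EFin \o \1_(Y @^-1` [set k])) w)%E.
  rewrite (bigD1 (Y w))//= big1 ?adde0 => [|k kY].
    by rewrite indicE mem_set// mule1.
  rewrite indicE memNset ?mule0// => /= Yk; by rewrite Yk eqxx in kY.
split.
  rewrite (_ : EFin \o _ = (fun w =>
    \sum_k (c k)%:E * (EFin \o \1_(Y @^-1` [set k])) w)%E); last first.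
    by apply/funext => w; rewrite -cE.
  exact: integrable_sum.
under eq_integral do rewrite cE.
rewrite integral_sum// -sumEFin; apply: eq_bigr => k _.
by rewrite integralZl// integral_indic// setIT EFinM -Pm.
Qed.

Section running_functional.
Variables (R : realType) (d : measure_display) (Omega : measurableType d).
Variables (P : probability Omega R) (I : finType) (t T : R).
Variables (X : R -> Omega -> I) (m : R -> I -> R) (H : I -> R -> R).
Hypothesis tT : t <= T.
Hypothesis mX : forall s k, t <= s <= T -> measurable (X s @^-1` [set k]).
Hypothesis rcX : forall w s, t <= s < T -> \forall u \near s^'+, X u w = X s w.
Hypothesis Pm : forall s k, t <= s <= T -> P (X s @^-1` [set k]) = (m s k)%:E.
Hypothesis iH : forall k,
  (@lebesgue_measure R).-integrable `[t, T] (EFin \o H k).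

Let leb := @lebesgue_measure R.
Let D : set (measurableTypeR R) := `[t, T]%classic.
Let E k : set (measurableTypeR R * Omega) :=
  [set z | t <= z.1 <= T /\ X z.1 z.2 = k].
(** The finite sum over states gives joint measurability term by term; [fE] recovers the value at
    the current state. *)
Let f (z : measurableTypeR R * Omega) := \sum_k (H k \_ D) z.1 * \1_(E k) z.

Let mD : measurable D. Proof. exact: measurable_itv. Qed.

Let DP s : (s \in D) = (t <= s <= T).
Proof. by apply/idP/idP => [/set_mem|tsT]; rewrite ?inE /D /= in_itv. Qed.

Let fE s w : f (s, w) = ((fun s => H (X s w) s) \_ D) s.
Proof.
rewrite /f/= [RHS]patchE; case: ifPn => sD; last first.
  by rewrite big1// => k _; rewrite patchE (negbTE sD) mul0r.
rewrite (bigD1 (X s w))//= big1 ?addr0 => [|k kX].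
  by rewrite patchE sD indicE mem_set ?mulr1//; split; rewrite // -DP.
by rewrite indicE memNset ?mulr0// => -[_ /= Xk]; rewrite Xk eqxx in kX.
Qed.

Let iH0 k : leb.-integrable setT (EFin \o (H k \_ D)).
Proof. by rewrite -restrict_EFin; exact: (proj1 (integrable_mkcond _ mD)). Qed.

Let if_ : (leb \x P)%E.-integrable setT (EFin \o f).
Proof.
apply: (@dominated_product_integrable _ _ _ _ _ _ _ _
  (fun s => \sum_k `|(H k \_ D) s|) (cst 1)).
- apply: measurable_sum => k; apply: measurable_funM.
    apply: measurableT_comp => //.
    by apply/measurable_EFinP/measurable_int/iH0.
  apply: measurable_indic; apply: measurable_right_continuous_process => //.
  by move=> s; exact: mX.
- rewrite (_ : EFin \o _ =
    (fun s => \sum_k (`|(H k \_ D) s|%R)%:E)%E); last first.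
    by apply/funext => s; rewrite /= -sumEFin.
  apply: integrable_sum => // k _; exact: (integrable_norm (iH0 k)).
- by apply: finite_measure_integrable_cst => //; exact: fin_num_measure.
- move=> s w; rewrite mulr1 (le_trans (ler_norm_sum _ _ _))//=.
  apply: ler_sum => k _; rewrite normrM ler_piMr//.
  by rewrite indicE; case: (_ \in _); rewrite ?normr1 ?normr0.
Qed.

Let GE : fubini_G leb (EFin \o f) =
  (fun w => \int[leb]_(s in `[t, T]) (H (X s w) s)%:E)%E.
Proof.
apply/funext => w; rewrite integral_mkcond; apply: eq_integral => s _.
by rewrite /= fE !patchE; case: ifP.
Qed.

Lemma running_functional_integrable :
  P.-integrable setT (fun w => \int[leb]_(s in `[t, T]) (H (X s w) s)%:E)%E.
Proof. by rewrite -GE; exact: integrable_fubini_G. Qed.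

(** Fubini exchanges time and expectation; at a fixed time the expectation is a finite sum against
    the marginal. *)
Lemma expected_running_functional :
  (\int[P]_w \int[leb]_(s in `[t, T]) (H (X s w) s)%:E =
   \int[leb]_(s in `[t, T]) (\sum_k H k s * m s k)%:E)%E.
Proof.
have := Fubini if_; rewrite -[RHS]/(\int[P]_w fubini_G leb (EFin \o f) w)%E.
rewrite GE => <-; rewrite [RHS]integral_mkcond; apply: eq_integral => s _.
rewrite patchE DP; case: ifPn => tsT; last first.
  by apply: integral0_eq => w _; rewrite /= fE patchE DP (negbTE tsT).
have [_ <-] := @finite_expectation _ _ _ P _ (X s) (H^~ s) (m s)
  (fun k => mX k tsT) (fun k => Pm k tsT).
by apply: eq_integral => w _; rewrite /= fE patchE DP tsT.
Qed.

End running_functional.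

(** * Verification *)

(** The start at i is deterministic, so the Markov property from time t, taken on the whole space,
    gives the law of X_s as row i of [p t s]. The forward equation of that row is the one stated. *)
Lemma markov_chain_marginal (R : realType) (N : nat) (V : 'I_N -> {set 'I_N})
    (d : measure_display) (Omega : measurableType d) (P : probability Omega R)
    (F : R -> set (set Omega)) (t T : R) (i : 'I_N) (l : control R N)
    (X : R -> Omega -> 'I_N) :
  usual_conditions P F -> t <= T -> markov_chain V P F t T i l X ->
  exists m : R -> 'I_N -> R,
    [/\ forall s k, t <= s <= T -> P (X s @^-1` [set k]) = (m s k)%:E,
        forall k, m t k = (i == k)%:R,
        forall k, (@lebesgue_measure R).-integrable `[t, T]
          (EFin \o (fun s => \sum_j m s j * intensity_mx V (l s) j k)) &
        forall k y, t <= y <= T -> m y k - m t k =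
          \int[@lebesgue_measure R]_(s in `[t, y])
            (\sum_j m s j * intensity_mx V (l s) j k)].
Proof.
move=> [sF _ _ _] tT [X0 _ _ _ [p kf mp]].
have XtE k : X t @^-1` [set k] = if i == k then setT else set0.
  by apply/seteqP; split=> w /=; rewrite X0; case: eqP.
have rE k : (fun v => (p t v *m intensity_mx V (l v)) i k) =
    (fun v => \sum_j p t v i j * intensity_mx V (l v) j k).
  by apply/funext => v; rewrite mxE.
have kfE k y : t <= y <= T -> p t y i k = (i == k)%:R +
    \int[@lebesgue_measure R]_(s in `[t, y])
      (\sum_j p t s i j * intensity_mx V (l s) j k).
  by move=> /andP[ty yT]; have [_ ->] := kf t y i k (lexx t) ty yT; rewrite rE.
have m0 k : p t t i k = (i == k)%:R.
  by rewrite kfE ?lexx ?tT// set_itv1 Rintegral_set1 addr0.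
exists (fun s k => p t s i k); split => //.
- move=> s k /andP[ts sT].
  have FT : F t setT.
    by case: (sF t) => -[F0 FC _] _; rewrite -(setD0 setT); exact: FC.
  have := mp t s i k setT (lexx t) ts sT FT.
  by rewrite XtE eqxx !setTI probability_setT mul1e.
- by move=> k; rewrite -rE; have [] := kf t T i k (lexx t) tT (lexx T).
- by move=> k y tyT; rewrite m0 kfE// addrC addKr.
Qed.

Section verification.
Variables (R : realType) (N : nat) (V : 'I_N -> {set 'I_N}).
Variables (lbar : 'I_N -> 'I_N -> R) (r g : 'I_N -> R).
Variables (d : measure_display) (Omega : measurableType d).
Variables (P : probability Omega R) (F : R -> set (set Omega)).
Hypotheses (hV : forall i, i \notin V i) (hF : usual_conditions P F).
Variables (t T : R) (v v' : 'I_N -> R -> R).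
Hypothesis tT : t <= T.
Hypothesis vT : forall k, v k T = g k.
Hypothesis cv : forall k, {within `[t, T], continuous (v k)}.
Hypothesis iv' : forall k,
  (@lebesgue_measure R).-integrable `[t, T] (EFin \o v' k).
Hypothesis vE : forall k x, t <= x <= T ->
  v k T - v k x = \int[@lebesgue_measure R]_(y in `[x, T]) v' k y.

Let leb := @lebesgue_measure R.
Let D : set (measurableTypeR R) := `[t, T]%classic.
Let mD : measurable D. Proof. exact: measurable_itv. Qed.

Section control.
Variables (i : 'I_N) (l : control R N) (X : R -> Omega -> 'I_N).
Hypothesis hX : markov_chain V P F t T i l X.
Hypothesis hl : admissible V t T l.

(** Time derivative of v plus the controlled generator applied to v: the integrand of Dynkin's
    formula. *)
Let H k s := v' k s + \sum_(j in V k) l s k j * (v j s - v k s).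

(** An integrable intensity times a difference of v, continuous and hence bounded on the segment,
    remains integrable. *)
Let iH k : leb.-integrable `[t, T] (EFin \o H k).
Proof.
rewrite (_ : EFin \o H k = (fun s => (EFin \o v' k) s +
  \sum_(j in V k) (EFin \o (fun s => l s k j * (v j s - v k s)%R)%R) s)%E);
  last first.
  by apply/funext => s; rewrite /= sumEFin.
apply: integrableD => //; apply: integrable_sum => // j jV.
have [_ il] := hl jV.
have cw : {within `[t, T], continuous (fun s => v j s - v k s)}.
  by move=> s; apply: cvgB; exact: cv.
apply: (@integrableMl _ _ _ leb D mD _ (fun s => v j s - v k s) il).
  exact: subspace_continuous_measurable_fun.
have /compact_bounded[M [_ mrt]] :=
  continuous_compact cw (segment_compact (a := t) (b := T)).
exists M; split; first by rewrite num_real.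
by move=> b Mb s sD; apply: (mrt b Mb); exists s.
Qed.

(** Dynkin's formula through the marginals: the expectation becomes a sum over states, and each
    state is integrated by parts, the density of its marginal being given by the forward
    equation. *)
Lemma expected_verification_functional :
  P.-integrable setT (fun w => \int[leb]_(s in `[t, T]) (H (X s w) s)%:E)%E /\
  P.-integrable setT (fun w => (g (X T w))%:E) /\
  (\int[P]_w \int[leb]_(s in `[t, T]) (H (X s w) s)%:E =
    \int[P]_w (g (X T w))%:E - (v i t)%:E)%E.
Proof.
have [m [Pm m0 irate mE]] := markov_chain_marginal hF tT hX.
have [sF _ _ _] := hF; have [_ FX rc _ _] := hX.
have mX s k : t <= s <= T -> measurable (X s @^-1` [set k]).
  by move=> tsT; apply: (sF s).2; apply: FX; rewrite in_itv.
have rcX w s : t <= s < T -> \forall u \near s^'+, X u w = X s w.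
  by move=> tsT; apply: rc; rewrite in_itv.
have TtT : t <= T <= T by rewrite tT lexx.
have [ig Eg] := @finite_expectation _ _ _ P _ (X T) g (m T)
  (fun k => mX T k TtT) (fun k => Pm T k TtT).
split; first exact: (running_functional_integrable P tT mX rcX iH).
split; first exact: ig.
rewrite (expected_running_functional tT mX rcX Pm iH) Eg.
have ibp k := Rintegration_by_parts_ac tT (irate k) (iv' k) (mE k) (@vE k).
(* The generator is transposed from v to the marginals, which produces the densities of the products
   m_k v_k. *)
have sumE s : \sum_k H k s * m s k = \sum_k
    ((\sum_j m s j * intensity_mx V (l s) j k) * v k s + m s k * v' k s).
  rewrite big_split/=.
  under [X in _ = X + _]eq_bigr => k _ do rewrite mulr_suml.
  rewrite exchange_big/= -big_split/=; apply: eq_bigr => k _.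
  rewrite /H -(intensity_mx_mul _ (v^~ s))// mulrDl addrC mulr_suml.
  rewrite [v' k s * _]mulrC.
  congr (_ + _); apply: eq_bigr => j _; ring.
under eq_integral do rewrite sumE -sumEFin.
rewrite integral_sum//; last by move=> k; have [] := ibp k.
rewrite (eq_bigr (fun k => (m T k * v k T - m t k * v k t)%:E)); last first.
  by move=> k _; have [ik <-] := ibp k; rewrite -Rintegral_EFin.
rewrite sumEFin -EFinD; congr EFin; rewrite sumrB; congr (_ - _).
  by apply: eq_bigr => k _; rewrite vT mulrC.
rewrite (bigD1 i)//= m0 eqxx mul1r big1 ?addr0// => k ki.
by rewrite m0 eq_sym (negbTE ki) mul0r.
Qed.

(** The costs are compared path by path, which allows a running cost of infinite integral; Dynkin's
    formula then evaluates the expectation of the bound as v_i(t). *)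
Lemma expected_reward_le :
  (forall s k, t <= s <= T -> H k s <= cost V lbar r k (l s k)) ->
  (expected_reward V lbar r g P t T l X <= (v i t)%:E)%E.
Proof.
move=> Hle; have [iHX [ig E]] := expected_verification_functional.
apply: (@le_trans _ _ (\int[P]_w
   ((g (X T w))%:E - (\int[leb]_(s in `[t, T]) (H (X s w) s)%:E)))%E).
  apply: le_integral_nonmeasurable => w _; rewrite addeC leeD2l// leeN2.
  apply: le_integral_nonmeasurable => s; rewrite /= in_itv/= => tsT.
  by rewrite lee_fin Hle.
rewrite integralB// E.
have := integrable_fin_num measurableT ig; case: (\int[P]_w _)%E => // a _.
by rewrite -!EFinB lee_fin; lra.
Qed.

Lemma expected_reward_eq :
  (forall s k, t <= s <= T -> H k s = cost V lbar r k (l s k)) ->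
  expected_reward V lbar r g P t T l X = (v i t)%:E.
Proof.
move=> HE; have [iHX [ig E]] := expected_verification_functional.
transitivity (\int[P]_w
   ((g (X T w))%:E - (\int[leb]_(s in `[t, T]) (H (X s w) s)%:E)))%E.
  apply: eq_integral => w _; rewrite addeC; congr (_ - _)%E.
  apply: eq_integral => s /set_mem; rewrite /= in_itv/= => tsT.
  by rewrite HE.
rewrite integralB// E.
have := integrable_fin_num measurableT ig; case: (\int[P]_w _)%E => // a _.
by rewrite -!EFinB; congr EFin; ring.
Qed.

End control.
End verification.

(** * Calculus on a segment and the entropic inequality *)

Section C1_on_segment.
Variables (R : realType) (t T : R) (v v' : R -> R).
Hypothesis dv : forall s, t <= s <= T -> is_derive s (1 : R) v (v' s).
Hypothesis cv' : forall s, t <= s <= T -> {for s, continuous v'}.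

Lemma C1_within_continuous : {within `[t, T], continuous v}.
Proof.
apply: derivable_within_continuous => s; rewrite in_itv/= => tsT.
by have [] := dv tsT.
Qed.

Lemma C1_derivative_integrable :
  (@lebesgue_measure R).-integrable `[t, T] (EFin \o v').
Proof.
apply: continuous_compact_integrable; first exact: segment_compact.
apply/continuous_in_subspaceT => s /set_mem; rewrite /= in_itv/=.
exact: cv'.
Qed.

Lemma C1_FTC x : t <= x <= T ->
  v T - v x = \int[@lebesgue_measure R]_(y in `[x, T]) v' y.
Proof.
move=> /andP[tx]; rewrite le_eqVlt => /predU1P[->|xT].
  by rewrite set_itv1 Rintegral_set1 subrr.
have seg s : x <= s <= T -> t <= s <= T.
  by move=> /andP[xs ->]; rewrite (le_trans tx xs).
have cv s : x <= s <= T -> {for s, continuous v}.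
  move=> /seg /dv [dvs _].
  by apply: differentiable_continuous; apply/derivable1_diffP.
rewrite /Rintegral (@continuous_FTC2 _ v' v)//.
- apply/continuous_in_subspaceT => s /set_mem; rewrite /= in_itv/= => xsT.
  exact/cv'/seg.
- split.
  + move=> s; rewrite in_itv/= => /andP[xs sT].
    have xsT : x <= s <= T by rewrite (ltW xs) (ltW sT).
    by have [] := dv (seg s xsT).
  + by apply/cvg_at_right_filter/cv; rewrite lexx ltW.
  + by apply/cvg_at_left_filter/cv; rewrite lexx ltW.
- move=> s; rewrite in_itv/= => /andP[xs sT].
  have xsT : x <= s <= T by rewrite (ltW xs) (ltW sT).
  by rewrite derive1E; have [_ ->] := dv (seg s xsT).
Qed.

End C1_on_segment.

(** For x > 0 this is ln y <= y - 1 at y = a q / x, multiplied by x, with equality at x = a q, the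
    form of the optimal control. For x = 0 only - a q <= 0 remains. *)
Lemma relative_entropy_young (R : realType) (x a q : R) :
  0 <= x -> 0 < a -> 0 < q -> x * ln q - a * q <= x * ln (x / a) - x.
Proof.
move=> x0 a0 q0; move: x0; rewrite le_eqVlt => /predU1P[<-|x0].
  by rewrite !mul0r !sub0r oppr0 oppr_le0 mulr_ge0 ?ltW.
have y0 : 0 < a * q / x by rewrite divr_gt0 ?mulr_gt0.
have : ln (a * q / x) <= a * q / x - 1.
  by rewrite -[X in ln X](subrKC 1) le_ln1Dx// ltrBrDl addrN.
rewrite ln_div ?posrE ?mulr_gt0// lnM ?posrE// ln_div ?posrE// => le_ln.
have := ler_wpM2l (ltW x0) le_ln.
rewrite (_ : x * (a * q / x - 1) = a * q - x); first lra.
by field; rewrite gt_eqF.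
Qed.

(** * The value function as the logarithm of the linear flow *)

Section value_function.
Variables (R : realType) (N : nat) (V : 'I_N -> {set 'I_N}).
Variables (lbar : 'I_N -> 'I_N -> R) (r g : 'I_N -> R).
Hypotheses (hV : forall i, i \notin V i).
Hypothesis hlbar : forall i j, j \in V i -> 0 < lbar i j.

Let B := reward_mx V lbar r.
Let w (T t : R) (i : 'I_N) : R := w_vec V lbar r g T t i 0.

Hypothesis w_gt0 : forall T t i, t <= T -> 0 < w T t i.

Lemma reward_mx_mul (x : 'cV[R]_N) i : (B *m x) i 0 =
  r i * x i 0 + \sum_(j in V i) lbar i j * (x j 0 - x i 0).
Proof.
rewrite /B /reward_mx mulmxDl mxE mul_diag_mx !mxE; congr (_ + _).
exact: (intensity_mx_mul _ (fun j => x j 0)).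
Qed.

(** Logarithmic change of unknown: w' = - B w in time, so ln w has derivative [v']. This is the
    Hamilton-Jacobi-Bellman equation with the supremum over intensities already computed. *)
Let v (T : R) (k : 'I_N) (s : R) : R := ln (w T s k).
Let v' (T : R) (k : 'I_N) (s : R) : R :=
  - r k - \sum_(j in V k) lbar k j * (w T s j / w T s k - 1).

Let is_derive_w (T : R) (k : 'I_N) (s : R) :
  is_derive s (1 : R) (fun s => w T s k)
  (- (r k * w T s k + \sum_(j in V k) lbar k j * (w T s j - w T s k))).
Proof.
have dw := is_derive_expmx_mul B (\col_i expR (g i)) k 0 (T - s).
have dx : is_derive s (1 : R) (fun s => T - s) (- 1).
  have := is_deriveB (is_derive_cst T s 1) (is_derive_id s (1 : R)).
  by rewrite sub0r.
have := @is_derive1_comp _ _ (fun s => T - s) _ _ _ dw dx.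
by rewrite reward_mx_mul mulrN1.
Qed.

Let w_cont (T : R) (k : 'I_N) (s : R) : {for s, continuous (fun s => w T s k)}.
Proof.
apply: differentiable_continuous; apply/derivable1_diffP.
by have [] := is_derive_w T k s.
Qed.

Let ratio_cont T k j s : s <= T ->
  {for s, continuous (fun s => w T s j / w T s k)}.
Proof.
move=> sT; apply: cvgM; first exact: w_cont.
by apply: cvgV; [rewrite gt_eqF// w_gt0|exact: w_cont].
Qed.

Let dv (T : R) (k : 'I_N) (s : R) :
  s <= T -> is_derive s (1 : R) (v T k) (v' T k s).
Proof.
move=> sT; have wk := w_gt0 k sT.
apply: (is_derive_eq (is_derive1_comp (is_derive1_ln wk) (is_derive_w T k s))).
rewrite mulrN mulrDr mulrCA mulVf ?gt_eqF// mulr1 opprD /v'; congr (_ - _).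
rewrite mulr_sumr; apply: eq_bigr => j _; field; exact: lt0r_neq0.
Qed.

Let cv' (T : R) (k : 'I_N) (s : R) : s <= T -> {for s, continuous (v' T k)}.
Proof.
move=> sT; apply: cvgB; first exact: cvg_cst.
apply: cvg_big => [|j _]; first exact: add_continuous.
apply: cvgMl_tmp; apply: cvgB; last exact: cvg_cst.
exact: ratio_cont.
Qed.

Lemma optimal_control_admissible T t :
  admissible V t T (optimal_control V lbar r g T).
Proof.
move=> k j jV; split.
  move=> s; rewrite in_itv/= => /andP[_ sT].
  by rewrite mulr_ge0 ?ltW ?hlbar// divr_gt0 ?w_gt0.
apply: continuous_compact_integrable; first exact: segment_compact.
apply/continuous_in_subspaceT => s /set_mem; rewrite /= in_itv/= => /andP[_ sT].
by apply: cvgMl_tmp; exact: ratio_cont.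
Qed.

Variables (d : measure_display) (Omega : measurableType d).
Variables (P : probability Omega R) (F : R -> set (set Omega)).
Variable X : R -> R -> 'I_N -> control R N -> R -> Omega -> 'I_N.
Hypothesis hF : usual_conditions P F.
Hypothesis hX : forall (T t : R) (i : 'I_N) (l : control R N),
  0 < T -> t <= T -> admissible V t T l ->
  markov_chain V P F t T i l (X T t i l).

(** The upper bound is the entropic inequality on each edge with q = w_j / w_k. It is attained by
    the feedback control, whose ratio to [lbar] is exactly q, the equality case. *)
Lemma value_ln T t i : 0 < T -> t <= T ->
  value V lbar r g P X T i t = (ln (w T t i))%:E.
Proof.
move=> T0 tT.
have vT k : v T k T = g k.
  by rewrite /v /w /w_vec subrr scale0r expmx0 mul1mx mxE expRK.
have dvT k s : t <= s <= T -> is_derive s (1 : R) (v T k) (v' T k s).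
  by move=> /andP[_ sT]; exact: dv.
have cvT k s : t <= s <= T -> {for s, continuous (v' T k)}.
  by move=> /andP[_ sT]; exact: cv'.
have c1 k := C1_within_continuous (dvT k).
have c2 k := C1_derivative_integrable (cvT k).
have c3 k := C1_FTC (dvT k) (cvT k).
have lnw s k j : s <= T -> v T j s - v T k s = ln (w T s j / w T s k).
  by move=> sT; rewrite /v ln_div// posrE w_gt0.
apply/eqP; rewrite eq_le; apply/andP; split.
  apply: ge_ereal_sup => _ [l ladm <-].
  apply: (expected_reward_le hV hF tT vT c1 c2 c3 (hX i T0 tT ladm) ladm).
  move=> s k tsT; have sT : s <= T by case/andP: tsT.
  rewrite /v' /cost -addrA lerD2l addrC -sumrB; apply: ler_sum => j jV.
  rewrite lnw//; have [l0 _] := ladm _ _ jV.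
  have l0s : 0 <= l s k j by apply: l0; rewrite in_itv.
  have q0 : 0 < w T s j / w T s k by rewrite divr_gt0 ?w_gt0.
  have := relative_entropy_young l0s (hlbar jV) q0; lra.
apply: ereal_sup_ubound; exists (optimal_control V lbar r g T).
  exact: optimal_control_admissible.
have ladm := @optimal_control_admissible T t.
apply: (expected_reward_eq hV hF tT vT c1 c2 c3 (hX i T0 tT ladm) ladm).
move=> s k tsT; have sT : s <= T by case/andP: tsT.
rewrite /v' /cost -addrA; congr (_ + _); rewrite addrC -sumrB.
apply: eq_bigr => j jV; rewrite lnw// /optimal_control -/(w T s j) -/(w T s k).
set q := w T s j / w T s k.
rewrite (_ : lbar k j * q / lbar k j = q); first ring.
by rewrite mulrAC mulfV ?mul1r// gt_eqF ?hlbar.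
Qed.

End value_function.

(** * Long-time asymptotics *)

Lemma cvg_near_EFin (R : realType) (T : Type) (F : set_system T)
    {FF : Filter F} (f : T -> \bar R) (h : T -> R) (l : R) :
  (\forall x \near F, f x = (h x)%:E) -> h x @[x --> F] --> l ->
  f x @[x --> F] --> l%:E.
Proof.
move=> fh hl; apply: cvg_EFin; first by near=> x; rewrite (near fh x).
by apply: cvg_trans hl; apply: near_eq_cvg; near=> x; rewrite /= (near fh x).
Unshelve. all: by end_near. Qed.

Theorem theorem3 (R : realType) (N : nat) (V : 'I_N -> {set 'I_N})
    (lbar : 'I_N -> 'I_N -> R) (r g : 'I_N -> R)
    (d : measure_display) (Omega : measurableType d) (P : probability Omega R)
    (F : R -> set (set Omega))
    (X : R -> R -> 'I_N -> control R N -> R -> Omega -> 'I_N)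
    (hN : (2 <= N)%N)
    (hV : forall i, i \notin V i)
    (hlbar : forall i j, j \in V i -> 0 < lbar i j)
    (hF : usual_conditions P F)
    (hX : forall (T t : R) (i : 'I_N) (l : control R N),
        0 < T -> t <= T -> admissible V t T l ->
        markov_chain V P F t T i l (X T t i l))
    (hconn : connected_graph V) :
  let B := reward_mx V lbar r in
  let u := value V lbar r g P X in
  real_spectrum B !=set0 /\
  exists gamma : R,
    [/\ real_spectrum B gamma,
        ubound (real_spectrum B) gamma,
        mup gamma (char_poly B) = 1%N &
        exists f : 'cV[R]_N,
          [/\ forall i, 0 < f i 0,
              forall v : 'cV[R]_N,
                B *m v = gamma *: v <-> exists c : R, v = c *: f,
              ergodic_constant u gamma,
              exists alpha : R, forall (i : 'I_N) (t : R),
                (u T i t - (gamma * (T - t))%:E)%E @[T --> +oo]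
                  --> (alpha + ln (f i 0))%:E &
              forall (i j : 'I_N) (t : R), j \in V i ->
                optimal_control V lbar r g T t i j @[T --> +oo]
                  --> lbar i j * (f j 0 / f i 0)]].
Proof.
move=> B u.
have i0 : 'I_N by exact: Ordinal (ltnW hN).
have BV i j : i != j -> B i j = if j \in V i then lbar i j else 0.
  by move=> ij; rewrite !mxE (negbTE ij) eq_sym (negbTE ij) mulr0n add0r.
have B0 i j : i != j -> 0 <= B i j.
  by move=> ij; rewrite BV//; case: ifP => // /hlbar/ltW.
(* Without self-loops the edges are off-diagonal, so walks of the graph run along positive entries
   of B. *)
have Bconn i j : exists2 p, path (fun a b => 0 < B a b) i p & last i p = j.
  have [p [_ ip pj]] := hconn i j; exists p => //.
  apply: sub_path ip => a b bVa; rewrite BV ?bVa ?hlbar//.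
  by apply: contraNneq (hV a) => ab; rewrite -ab in bVa.
have [f [gamma [f0 Bf]]] := metzler_perron B0 Bconn i0.
have E0 := metzler_expmx_ge0 B0; have E1 := metzler_expmx_gt0 B0 Bconn.
have simple := positive_flow_mup_char_poly i0 f0 Bf E0 E1.
have gspec : real_spectrum B gamma.
  rewrite /real_spectrum /= eigenvalue_root_char -dvdp_XsubCl -[_ - _]expr1.
  by rewrite -mup_geq ?simple// monic_neq0// char_poly_monic.
split; first by exists gamma.
exists gamma; split => //.
  move=> x /eigenvalueP[v vB vn0].
  (* [eigenvalue] speaks of row vectors; the determinant of the transpose provides a column
     eigenvector for the same value. *)
  have /det0P[y yn0 yB] : \det (B - x%:M)^T == 0.
    rewrite det_tr; apply/det0P; exists v => //.
    by rewrite mulmxBr vB mul_mx_scalar subrr.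
  apply: (positive_flow_eigen_le i0 f0 Bf E0 E1 (v := y^T)).
    by rewrite -(inj_eq trmx_inj) trmxK trmx0.
  apply/eqP; rewrite -subr_eq0 -mul_scalar_mx -mulmxBl.
  by rewrite -[_ - _]trmxK -trmx_mul yB trmx0.
pose G : 'cV[R]_N := \col_i expR (g i).
have G0 i : 0 < G i 0 by rewrite mxE expR_gt0.
(* A positive multiple of f below the terminal vector keeps [h] above a at nonnegative times, so
   that w and the limit c are positive and have logarithms. *)
have [a /andP[a0 _] aG] : exists2 a : R, 0 < a <= 1 &
    forall i, a <= G i 0 / f i 0.
  by apply: pos_finfun_lbound => i; rewrite divr_gt0.
have {}aG i : a * f i 0 <= G i 0 by rewrite -ler_pdivlMr.
pose h x i := expR (- (gamma * x)) * (expmx (x *: B) *m G) i 0 / f i 0.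
have h_ge x i : 0 <= x -> a <= h x i.
  by move=> x0; exact: (positive_flow_ge f0 Bf E0 i x0 aG).
have wE T t i : w_vec V lbar r g T t i 0 =
    expR (gamma * (T - t)) * (h (T - t) i * f i 0).
  rewrite /h divfK ?gt_eqF// mulrA expRN mulfV ?mul1r//.
  by rewrite gt_eqF ?expR_gt0.
have w_gt0 T t i : t <= T -> 0 < w_vec V lbar r g T t i 0.
  move=> tT; rewrite wE; apply: mulr_gt0; first exact: expR_gt0.
  apply: mulr_gt0 => //.
  by apply: (lt_le_trans a0); apply: h_ge; rewrite subr_ge0.
have [c hc] := expmx_doob_cvg i0 G f0 Bf E0 E1.
have c0 : 0 < c.
  apply: (lt_le_trans a0); apply: (cvgr_to_ge (hc i0)).
  by near=> x; apply: h_ge.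
have hct t i : h (T - t) i @[T --> +oo] --> c.
  exact: (cvg_comp _ _ (cvg_addrr (- t)) (hc i)).
(* The identity with ln w holds once T > 0 and T >= t, which is enough for limits in T. *)
have uE t i : \forall T \near +oo, u T i t = (ln (w_vec V lbar r g T t i 0))%:E.
  near=> T; apply: (value_ln hV hlbar _ hF hX).
  - by move=> *; exact: w_gt0.
  - by near: T; apply: nbhs_pinfty_gt; exact: num_real.
  - by near: T; apply: nbhs_pinfty_ge; exact: num_real.
have ln_expM (x y z : R) : 0 < y -> 0 < z ->
    ln (expR x * (y * z)) = x + (ln y + ln z).
  by move=> y0 z0; rewrite !lnM ?posrE ?mulr_gt0 ?expR_gt0// expRK.
have lnw t i : ln (w_vec V lbar r g T t i 0) - gamma * (T - t) @[T --> +oo] -->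
    ln c + ln (f i 0).
  have : ln (h (T - t) i) + ln (f i 0) @[T --> +oo] --> ln c + ln (f i 0).
    apply: cvgD; last exact: cvg_cst.
    by apply: (cvg_comp _ _ (hct t i)); exact: continuous_ln.
  apply: cvg_trans; apply: near_eq_cvg; near=> T.
  have h0 : 0 < h (T - t) i.
    apply: (lt_le_trans a0); apply: h_ge; rewrite subr_ge0.
    by near: T; apply: nbhs_pinfty_ge; exact: num_real.
  by rewrite wE ln_expM// [RHS]addrC addKr.
exists f; split => //.
- move=> v; split=> [Bv|[k ->]]; last first.
    by rewrite -scalemxAr Bf !scalerA mulrC.
  (* An eigenvector satisfies the Jordan relation with c = 0. *)
  have [] := @positive_flow_jordan _ _ i0 _ _ _ f0 Bf E0 E1 v 0 _ => //.
  by rewrite scale0r addr0.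
(* u / T is split as (u - gamma (T - t)) / T + gamma - gamma t / T, where the first numerator
   converges. *)
- move=> i t; apply: (@cvg_near_EFin _ _ _ _ _
    (fun T => (ln (w_vec V lbar r g T t i 0) - gamma * (T - t)) * T^-1
       + (gamma - gamma * t * T^-1))).
    near=> T; rewrite (near (uE t i) T)// -EFinM; congr EFin.
    have T0 : T != 0.
      by rewrite gt_eqF//; near: T; apply: nbhs_pinfty_gt; exact: num_real.
    by field.
  have Tinv : T^-1 @[T --> +oo] --> (0 : R).
    apply/gtr0_cvgV0; last exact: cvg_id.
    by near=> T; near: T; apply: nbhs_pinfty_gt; exact: num_real.
  rewrite -[X in _ --> X](_ :
      (ln c + ln (f i 0)) * 0 + (gamma - gamma * t * 0) = gamma).
    apply: cvgD; first exact: cvgM.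
    by apply: cvgB; [exact: cvg_cst|exact: cvgMl_tmp].
  by rewrite !mulr0 subr0 add0r.
(* c is the limit, common to all nodes, of the transform of the terminal vector. *)
- exists (ln c) => i t; apply: (@cvg_near_EFin _ _ _ _ _
    (fun T => ln (w_vec V lbar r g T t i 0) - gamma * (T - t))) => //.
  by near=> T; rewrite (near (uE t i) T).
(* The exponential factor cancels in the ratio of coordinates of w, and c cancels in its limit. *)
- move=> i j t jV; rewrite /optimal_control; apply: cvgMl_tmp.
  have : h (T - t) j * f j 0 / (h (T - t) i * f i 0) @[T --> +oo] -->
      c * f j 0 / (c * f i 0).
    apply: cvgM; first exact: cvgMr_tmp.
    by apply: cvgV; [rewrite mulf_neq0 ?gt_eqF|exact: cvgMr_tmp].
  rewrite (_ : c * f j 0 / (c * f i 0) = f j 0 / f i 0); last first.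
    by field; rewrite !gt_eqF.
  apply: cvg_trans; apply: near_eq_cvg; near=> T; rewrite !wE.
  by rewrite -[RHS]mulf_div divff ?mul1r// gt_eqF ?expR_gt0.
Unshelve. all: by end_near. Qed.
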